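(* Let $\mathcal{M}_1=(V,\mathcal{I}_1)$ and $\mathcal{M}_2=(V,\mathcal{I}_2)$ be matroids on a common ground set $V$ with $n=|V|$, given via independence oracles, and let $r$ be the size of a largest common independent set. For any $\epsilon>0$ one can find a point $z\in\mathcal{P}_{\mathcal{M}_1}\cap\mathcal{P}_{\mathcal{M}_2}$ with $\sum_{i\in V}z_i\ge(1-\epsilon)r$ using an iterative algorithm with $O\!\left(\frac{n}{r\epsilon^{2}}\right)$ iterations, each of which takes $O(n\cdot\mathcal{T}_{\mathrm{ind}})$ time.
   Context: A matroid $\mathcal{M}=(V,\mathcal{I})$ is a finite ground set with a family of independent sets containing $\emptyset$, closed under subsets, satisfying the exchange property. The matroid polytope $\mathcal{P}_{\mathcal{M}}\subseteq\mathbb{R}^V$ is the convex hull of the indicator vectors of the independent sets of $\mathcal{M}$. An independence oracle for $\mathcal{M}_i$ answers whether a queried $S\subseteq V$ lies in $\mathcal{I}_i$; $\mathcal{T}_{\mathrm{ind}}$ is the maximum time of one query. *)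

(* Defs.v *)
From HB Require Import structures.
From mathcomp Require Import all_boot all_order all_algebra.
From mathcomp Require Import reals.
Set Implicit Arguments.
Unset Strict Implicit.
Unset Printing Implicit Defensive.
Import Order.TTheory GRing.Theory Num.Theory.
Local Open Scope ring_scope.

Record matroid (V : finType) := Matroid {
  indep : {set {set V}};
  indep0 : set0 \in indep;
  indepS : forall A B : {set V}, A \subset B -> B \in indep -> A \in indep;
  indep_exchange : forall A B : {set V},
    A \in indep -> B \in indep -> (#|A| < #|B|)%N ->
    exists2 x, x \in B :\: A & x |: A \in indep
}.

(* The size of a largest common independent set. *)
Definition max_common (V : finType) (M1 M2 : matroid V) : nat :=
  \max_(S in indep M1 :&: indep M2) #|S|.

Definition indicator (R : realType) (V : finType) (S : {set V}) :
  {ffun V -> R} := [ffun v => (v \in S)%:R].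

(* Convex combinations of the (finitely many) points [indicator R S], S
   independent. *)
Definition in_matroid_polytope (R : realType) (V : finType) (M : matroid V)
    (z : {ffun V -> R}) : Prop :=
  exists lam : {set V} -> R,
    [/\ forall S, S \in indep M -> 0 <= lam S,
        \sum_(S in indep M) lam S = 1
      & forall v, z v = \sum_(S in indep M) lam S * indicator R S v].

(* ------------------------------------------------------------------------ *)
(* Model of computation: a deterministic real RAM with two independence     *)
(* oracles.  Memory consists of arrays of naturals and arrays of reals,     *)
(* named by naturals and indexed by naturals.  A program is a piece of      *)
(* syntax, hence finite and the same for all inputs.  The only operations   *)
(* on naturals are addition and truncated subtraction, and there is no      *)
(* rounding from reals to naturals, so that charging unit cost is           *)
(* legitimate.                                                              *)
(* ------------------------------------------------------------------------ *)

Inductive nexp : Type :=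
| NConst of nat
| NGet of nat & nexp
| NAdd of nexp & nexp
| NSub of nexp & nexp.

Inductive rexp : Type :=
| ROfNat of nexp
| RGet of nat & nexp
| RAdd of rexp & rexp
| RSub of rexp & rexp
| RMul of rexp & rexp
| RDiv of rexp & rexp.

Inductive bexp : Type :=
| BNEq of nexp & nexp
| BNLt of nexp & nexp
| BRLe of rexp & rexp
| BNot of bexp
| BAnd of bexp & bexp.

(* [NSet a i e] is a[i] := e on arrays of naturals, [RSet] the same on arrays
   of reals.  [Query k a d] asks oracle k (false: first matroid, true: second
   matroid) about the set of elements whose entry in array a is nonzero, and
   writes the answer to d[0]. *)
Inductive cmd : Type :=
| Skip
| NSet of nat & nexp & nexp
| RSet of nat & nexp & rexp
| Query of bool & nat & nat
| Seq of cmd & cmd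
| If of bexp & cmd & cmd
| While of bexp & cmd.

(* The program  init; while guard do body. *)
Record iterative_algorithm : Type := IterAlg {
  init : cmd;
  guard : bexp;
  body : cmd
}.

Record state (R : realType) : Type := State {
  nmem : nat -> nat -> nat;
  rmem : nat -> nat -> R
}.

Section Semantics.
Variables (R : realType) (V : finType).
Variables (M1 M2 : matroid V).
(* [t1 S], [t2 S]: time the two oracles take to answer the query S. *)
Variables (t1 t2 : {set V} -> nat).

Definition upd (T : Type) (f : nat -> nat -> T) (a i : nat) (x : T) :
    nat -> nat -> T :=
  fun b j => if (b == a) && (j == i) then x else f b j.

Fixpoint neval (s : state R) (e : nexp) : nat :=
  match e with
  | NConst c => c
  | NGet a i => nmem s a (neval s i)
  | NAdd e1 e2 => (neval s e1 + neval s e2)%N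
  | NSub e1 e2 => (neval s e1 - neval s e2)%N
  end.

Fixpoint reval (s : state R) (e : rexp) : R :=
  match e with
  | ROfNat i => (neval s i)%:R
  | RGet a i => rmem s a (neval s i)
  | RAdd e1 e2 => reval s e1 + reval s e2
  | RSub e1 e2 => reval s e1 - reval s e2
  | RMul e1 e2 => reval s e1 * reval s e2
  | RDiv e1 e2 => reval s e1 / reval s e2
  end.

Fixpoint beval (s : state R) (b : bexp) : bool :=
  match b with
  | BNEq e1 e2 => neval s e1 == neval s e2
  | BNLt e1 e2 => (neval s e1 < neval s e2)%N
  | BRLe e1 e2 => reval s e1 <= reval s e2
  | BNot b1 => ~~ beval s b1
  | BAnd b1 b2 => beval s b1 && beval s b2
  end.

(* The ground set is presented to the program as {0, ..., n-1}, through
   [enum_rank]. *)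
Definition query_set (s : state R) (a : nat) : {set V} :=
  [set v | nmem s a (enum_rank v) != 0%N].

Definition oracle (k : bool) (S : {set V}) : bool :=
  S \in indep (if k then M2 else M1).

Definition query_time (k : bool) (S : {set V}) : nat :=
  if k then t2 S else t1 S.

(* [exec c s s' k]: command c started in state s halts in state s' after time
   k.  Every assignment or test costs one unit (the expressions have constant
   size since the program is fixed), and a query costs the time its oracle
   takes. *)
Inductive exec : cmd -> state R -> state R -> nat -> Prop :=
| exec_skip s : exec Skip s s 1
| exec_nset a i e s :
    exec (NSet a i e) s
      (State (upd (nmem s) a (neval s i) (neval s e)) (rmem s)) 1
| exec_rset a i e s :
    exec (RSet a i e) s
      (State (nmem s) (upd (rmem s) a (neval s i) (reval s e))) 1
| exec_query k a d s :
    exec (Query k a d) s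
      (State (upd (nmem s) d 0 (oracle k (query_set s a) : nat)) (rmem s))
      (query_time k (query_set s a))
| exec_seq c1 c2 s s1 s2 k1 k2 :
    exec c1 s s1 k1 -> exec c2 s1 s2 k2 -> exec (Seq c1 c2) s s2 (k1 + k2)
| exec_if b c1 c2 s s1 k :
    exec (if beval s b then c1 else c2) s s1 k -> exec (If b c1 c2) s s1 k.+1
| exec_while_stop b c s :
    ~~ beval s b -> exec (While b c) s s 1
| exec_while_step b c s s1 s2 k1 k2 :
    beval s b -> exec c s s1 k1 -> exec (While b c) s1 s2 k2 ->
    exec (While b c) s s2 (k1 + k2).+1.

(* [iterate b c s s' ks]: the loop  while b do c  started in s halts in s';
   ks lists the time taken by each of its iterations, including the test of
   b. *)
Inductive iterate (b : bexp) (c : cmd) :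
    state R -> state R -> seq nat -> Prop :=
| iterate_stop s : ~~ beval s b -> iterate b c s s [::]
| iterate_step s s1 s2 k ks :
    beval s b -> exec c s s1 k -> iterate b c s1 s2 ks ->
    iterate b c s s2 (k.+1 :: ks).

(* Input: n in cell 0 of natural array 0 and eps in cell 0 of real array 0;
   everything else is zero.  The matroids are accessible through [Query]
   only. *)
Definition input_state (eps : R) : state R :=
  State (upd (fun _ _ => 0%N) 0 0 #|V|) (upd (fun _ _ => 0) 0 0 eps).

(* Output: cells 0, ..., n-1 of real array 1. *)
Definition output (s : state R) : {ffun V -> R} :=
  [ffun v => rmem s 1 (enum_rank v)].

(* [run A eps z k0 ks]: on accuracy eps, A halts with output z; its
   iterations take the times listed in ks, and k0 is the time spent outside
   the iterations, namely in the initialization and the last (failing) test of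
   the guard. *)
Definition run (A : iterative_algorithm) (eps : R) (z : {ffun V -> R})
    (k0 : nat) (ks : seq nat) : Prop :=
  exists s0 s1 : state R, exists k : nat,
    [/\ exec (init A) (input_state eps) s0 k,
        iterate (guard A) (body A) s0 s1 ks,
        z = output s1
      & k0 = k.+1].

End Semantics.

(* Maximum time of one query, over both oracles and all query sets. *)
Definition Tind (V : finType) (t1 t2 : {set V} -> nat) : nat :=
  \max_(S : {set V}) maxn (t1 S) (t2 S).

(* Main.v *)
(** Finding [x1] in the first polytope and [x2] in the second one that maximize
    [\sum_v min(x1 v, x2 v)] is a zero-sum game: the adversary picks weights [w]
    in [0, 1]^V, and the best responses are the greedy bases for [w] in the first
    matroid and for [1 - w] in the second one.  Projected subgradient descent on
    [w] moves each weight by at most one step of size about [eps / 4], so integer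
    weights in [0, K] with K = ceil (4 / eps) suffice, and the output is the
    coordinatewise minimum of the two averages of greedy sets.

    The subgradients have squared norm at most the sum of the two ranks.  To make
    this O(r), a maximal common independent set, of size r0 with
    r0 <= r <= 2 * r0, is computed first, and both matroids are truncated to rank
    2 * r0; the regret bound then gives O(n / (r * eps^2)) iterations.

    Sorting in every iteration would cost too much.  As weights change by one, an
    element is moved to the next weight class by one exchange with the boundary
    of its class in the sorted array, in constant time. *)
Require Import Defs.
From mathcomp Require Import all_boot all_order all_algebra.
From mathcomp Require Import reals.
From mathcomp Require boolp.
From mathcomp Require Import zify lra.
Set Implicit Arguments.
Unset Strict Implicit.
Unset Printing Implicit Defensive.
Import Order.TTheory GRing.Theory Num.Theory.
Local Open Scope ring_scope.

(** * Matroids *)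

Section Matroids.
Variable V : finType.
Implicit Types (M : matroid V) (S T I O : {set V}).

Section Truncation.
Variables (M : matroid V) (k : nat).

Definition trunc_indep : {set {set V}} := [set S in indep M | (#|S| <= k)%N].

Lemma trunc_indep0 : set0 \in trunc_indep.
Proof. by rewrite inE indep0 cards0. Qed.

Lemma trunc_indepS S T :
  S \subset T -> T \in trunc_indep -> S \in trunc_indep.
Proof.
move=> sST; rewrite !inE => /andP[iT leT]; rewrite (indepS sST iT) /=.
exact: leq_trans (subset_leq_card sST) leT.
Qed.

Lemma trunc_exchange S T :
  S \in trunc_indep -> T \in trunc_indep -> (#|S| < #|T|)%N ->
  exists2 x, x \in T :\: S & x |: S \in trunc_indep.
Proof.
rewrite !inE => /andP[iS _] /andP[iT leT] ltST.
have [x xTS iSx] := indep_exchange iS iT ltST; exists x => //.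
rewrite inE iSx cardsU1; move: xTS; rewrite inE => /andP[-> _] /=.
exact: leq_trans ltST leT.
Qed.

Definition trunc : matroid V :=
  Matroid trunc_indep0 trunc_indepS trunc_exchange.

Lemma trunc_setU1 x S : x \notin S ->
  (x |: S \in indep trunc) = (x |: S \in indep M) && (#|S| < k)%N.
Proof. by move=> xS; rewrite inE cardsU1 xS. Qed.

Lemma truncW S : S \in indep trunc -> S \in indep M.
Proof. by rewrite inE => /andP[]. Qed.

Lemma trunc_card S : S \in indep trunc -> (#|S| <= k)%N.
Proof. by rewrite inE => /andP[]. Qed.

End Truncation.

(* [I] is an output of the greedy algorithm run on [M] by increasing [key]. *)
Definition greedy_set M (key : V -> nat) I : Prop :=
  I \in indep M /\
  forall x, x \notin I ->
    x |: [set y in I | (key y < key x)%N] \notin indep M.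

(** If [I] had fewer elements in [L] than [O], an exchange would add some [x] of [O] to [I :&: L].
    As [L] is closed under smaller keys, the part of [I] before [x] lies in [I :&: L], so the greedy
    algorithm would have accepted [x]. *)
Lemma greedy_card_le M key I (L : {set V}) O :
  greedy_set M key I -> O \in indep M ->
  (forall x y, x \in L -> (key y < key x)%N -> y \in L) ->
  (#|O :&: L| <= #|I :&: L|)%N.
Proof.
move=> [iI maxI] iO closedL; rewrite leqNgt; apply/negP => ltIO.
have iIL : I :&: L \in indep M by apply: indepS iI; apply: subsetIl.
have iOL : O :&: L \in indep M by apply: indepS iO; apply: subsetIl.
have [x] := indep_exchange iIL iOL ltIO.
rewrite !inE => /andP[xIL /andP[xO xL]]; move: xIL; rewrite xL andbT => xI.
move=> ix; case/negP: (maxI x xI); apply: indepS ix.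
apply: setUS; apply/subsetP => y; rewrite !inE => /andP[-> ltyx].
exact: closedL ltyx.
Qed.

(** Layer-cake summation: it reduces weights to counting in level sets. *)
Lemma sum_level_sets (K : nat) (w : V -> nat) S :
  (forall x, w x <= K)%N ->
  (\sum_(x in S) w x = \sum_(k < K) #|S :&: [set x | k < w x]|)%N.
Proof.
move=> wK.
have count_below m : (m <= K)%N -> (\sum_(k < K) (k < m : nat) = m)%N.
  elim: K {wK} m => [|K IH] m leK; first by rewrite big_ord0; lia.
  rewrite big_ord_recr /=; have [ltKm|leKm] := ltnP K m; last by rewrite IH ?addn0.
  have -> : m = K.+1 by lia.
  rewrite addn1 -[in RHS](IH K) //; congr _.+1; apply: eq_bigr => k _.
  by rewrite ltn_ord ltnW // ltnS ltn_ord.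
have cardE (k : 'I_K) :
    #|S :&: [set x | (k < w x)%N]| = (\sum_(x in S) (k < w x : nat))%N.
  rewrite -sum1_card [RHS]big_mkcond [LHS]big_mkcond.
  by apply: eq_bigr => x _; rewrite !inE; case: (x \in S) => //=; case: ltnP.
under [RHS]eq_bigr => k _ do rewrite cardE.
by rewrite exchange_big; apply: eq_bigr => x _ /=; exact/esym/count_below.
Qed.

(** The weights weakly decrease along [key], so their level sets are closed under smaller keys and
    the cardinality comparison applies to each. *)
Lemma greedy_weight_ge M key I O (w : V -> nat) :
  greedy_set M key I -> O \in indep M ->
  (forall x y, (key y < key x)%N -> (w x <= w y)%N) ->
  (\sum_(x in O) w x <= \sum_(x in I) w x)%N.
Proof.
move=> gI iO mono.
have wK x : (w x <= \max_y w y)%N by apply: leq_bigmax.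
rewrite !(sum_level_sets _ wK); apply: leq_sum => k _.
apply: greedy_card_le gI iO _ => x y; rewrite !inE => ltkx ltyx.
exact: leq_trans ltkx (mono _ _ ltyx).
Qed.

Lemma max_common_ge M1 M2 S :
  S \in indep M1 -> S \in indep M2 -> (#|S| <= max_common M1 M2)%N.
Proof.
move=> i1 i2; rewrite /max_common (bigD1 S) ?inE ?i1 //=; exact: leq_maxl.
Qed.

Lemma max_common_witness M1 M2 :
  exists O, [/\ O \in indep M1, O \in indep M2 & #|O| = max_common M1 M2].
Proof.
have ne : (0 < #|indep M1 :&: indep M2|)%N.
  by apply/card_gt0P; exists set0; rewrite inE !indep0.
have [O] := eq_bigmax_cond (fun T : {set V} => #|T|) ne.
by rewrite inE => /andP[i1 i2] eqO; exists O; split.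
Qed.

(** Every element of [O] outside [S] is blocked in one of the matroids. In either matroid at most
    [#|S|] elements of [O] lie in [S] or are blocked; otherwise an exchange would extend [S] by an
    element that is not blocked. *)
Lemma maximal_common_half M1 M2 S :
  S \in indep M1 -> S \in indep M2 ->
  (forall x, x \notin S ->
    ~~ ((x |: S \in indep M1) && (x |: S \in indep M2))) ->
  (max_common M1 M2 <= 2 * #|S|)%N.
Proof.
move=> i1 i2 maxS; have [O [o1 o2 <-]] := max_common_witness M1 M2.
pose L M := [set x | (x \in S) || (x |: S \notin indep M)].
have bound M : S \in indep M -> O \in indep M -> (#|O :&: L M| <= #|S|)%N.
  move=> iS iO; rewrite leqNgt; apply/negP => lt.
  have iOL : O :&: L M \in indep M by apply: indepS iO; apply: subsetIl.
  have [x] := indep_exchange iS iOL lt.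
  by rewrite !inE => /and3P[/negPf-> _ /=] /negPf->.
have sub : O \subset (O :&: L M1) :|: (O :&: L M2).
  apply/subsetP => x xO; rewrite !inE xO /=.
  by case xS: (x \in S) => //=; rewrite -negb_and maxS ?xS.
apply: leq_trans (subset_leq_card sub) _.
apply: leq_trans (leq_card_setU _ _) _.
by rewrite mul2n -addnn leq_add ?bound.
Qed.

(** * Membership in the matroid polytope *)

(** Surplus memberships can be deleted set by set, as subsets stay independent; this lets the
    coordinatewise minimum of two averages remain in both polytopes. *)
Lemma thin_sets M (Is : seq {set V}) (m : V -> nat) :
  all (mem (indep M)) Is ->
  (forall x, m x <= count (fun S : {set V} => x \in S) Is)%N ->
  exists Is' : seq {set V}, [/\ size Is' = size Is, all (mem (indep M)) Is'
    & forall x, count (fun S : {set V} => x \in S) Is' = m x].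
Proof.
elim: Is m => [|S Is IH] m /=.
  by move=> _ m0; exists [::]; split=> // x /=; have := m0 x; lia.
case/andP=> iS iIs mS.
pose c x := count (fun S : {set V} => x \in S) Is.
have [||Is' [sz i' cnt]] := IH (fun x => minn (m x) (c x)); first exact: iIs.
  by move=> x; exact: geq_minr.
(* The head keeps [x] only when the tail alone cannot supply [m x] memberships. *)
exists ([set x in S | (c x < m x)%N] :: Is'); split=> /=; first by rewrite sz.
  rewrite i' andbT; apply: indepS iS; apply/subsetP=> x.
  by rewrite inE => /andP[].
move=> x; rewrite cnt inE; have := mS x; rewrite -/(c x).
by case: (x \in S) => /=; lia.
Qed.

Lemma average_in_polytope (R : realType) M (Is : seq {set V}) (z : {ffun V -> R}) :
  (0 < size Is)%N -> all (mem (indep M)) Is ->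
  (forall x, z x =
    (count (fun S : {set V} => x \in S) Is)%:R / (size Is)%:R) ->
  in_matroid_polytope M z.
Proof.
move=> sz iIs zE; exists (fun S => (count_mem S Is)%:R / (size Is)%:R).
have sumE (F : {set V} -> R) : \sum_(S in indep M) (count_mem S Is)%:R * F S
    = \sum_(S <- Is) F S.
  elim: Is iIs {sz zE} => [|S Is IH] /=.
    by rewrite big_nil => _; apply: big1 => S _; rewrite mul0r.
  case/andP=> iS iIs; rewrite big_cons -(IH iIs).
  under eq_bigr => T _ do rewrite natrD mulrDl.
  rewrite big_split /=; congr (_ + _); rewrite (bigD1 S) //= eqxx mul1r.
  rewrite big1 ?addr0 // => T /andP[_ /negPf nT].
  by rewrite eq_sym nT mul0r.
have sz0 : (size Is)%:R != 0 :> R by rewrite pnatr_eq0 -lt0n.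
split.
- by move=> S _; rewrite divr_ge0 ?ler0n.
- by rewrite (sumE (fun=> _)) big_const_seq count_predT iter_addr_0
    -[_ *+ _]mulr_natr mulVf.
move=> x; rewrite zE -sum1_count natr_sum mulr_suml big_mkcond /=.
under [RHS]eq_bigr => S _ do rewrite -mulrA.
rewrite sumE; apply: eq_bigr => S _; rewrite ffunE.
by case: (x \in S); rewrite ?mulr1 ?mulr0 // mul1r.
Qed.

Lemma below_average_in_polytope (R : realType) M (Is : seq {set V})
    (m : V -> nat) (z : {ffun V -> R}) :
  all (mem (indep M)) Is ->
  (forall x, m x <= count (fun S : {set V} => x \in S) Is)%N ->
  (forall x, z x = (m x)%:R / (size Is)%:R) ->
  in_matroid_polytope M z.
Proof.
move=> iIs mIs zE; have [Is' [sz i' cnt]] := thin_sets iIs mIs.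
(* An empty list, from a run without iterations, gives [z = 0] because division by zero yields 0;
   this is the indicator of the empty set. *)
case: (posnP (size Is)) => [s0|spos].
  apply: (@average_in_polytope R M [:: set0]) => //=; first by rewrite indep0.
  by move=> x; rewrite zE s0 invr0 mulr0 inE /= mul0r.
apply: (@average_in_polytope R M Is'); rewrite ?sz // => x.
by rewrite cnt zE.
Qed.

End Matroids.

(** * Total correctness with cost bounds *)

Section Hoare.
Variables (R : realType) (V : finType) (M1 M2 : matroid V).
Variables (t1 t2 : {set V} -> nat).
Implicit Types (c : cmd) (s : state R) (Q : state R -> Prop).

(** [exec] relates halting runs only, so this is a total correctness triple with a time budget. *)
Definition runs c s (B : nat) Q : Prop :=
  exists s' k, [/\ exec M1 M2 t1 t2 c s s' k, (k <= B)%N & Q s'].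

(* For loop-free commands only, hence [False] on [While]. *)
Fixpoint wp c s Q : Prop :=
  match c with
  | Skip => Q s
  | NSet a i e => Q (State (upd (nmem s) a (neval s i) (neval s e)) (rmem s))
  | RSet a i e => Q (State (nmem s) (upd (rmem s) a (neval s i) (reval s e)))
  | Query k a d =>
      Q (State (upd (nmem s) d 0 (oracle M1 M2 k (query_set V s a) : nat))
               (rmem s))
  | Seq c1 c2 => wp c1 s (fun s1 => wp c2 s1 Q)
  | If b c1 c2 => if beval s b then wp c1 s Q else wp c2 s Q
  | While _ _ => False
  end.

(** An upper bound: a conditional is charged for both of its branches. *)
Fixpoint cost (T : nat) c : nat :=
  match c with
  | Query _ _ _ => T
  | Seq c1 c2 => cost T c1 + cost T c2
  | If _ c1 c2 => (cost T c1 + cost T c2).+1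
  | _ => 1
  end.

Lemma query_time_le k S : (query_time t1 t2 k S <= Tind t1 t2)%N.
Proof.
rewrite /Tind (bigD1 S) //= leq_max; apply/orP; left.
by case: k; rewrite leq_max leqnn ?orbT.
Qed.

Lemma runs_wp c s B Q :
  wp c s Q -> (cost (Tind t1 t2) c <= B)%N -> runs c s B Q.
Proof.
suff main : wp c s Q -> runs c s (cost (Tind t1 t2) c) Q.
  by move=> /main[s' [k [e b q]]] leB; exists s', k; split=> //; exact: leq_trans leB.
elim: c s Q => /= [|a i e|a i e|k a d|c1 IH1 c2 IH2|b c1 IH1 c2 IH2|//] s Q H.
- by exists s, 1%N; split=> //; constructor.
- by eexists; exists 1%N; split; [constructor| |exact: H].
- by eexists; exists 1%N; split; [constructor| |exact: H].
- eexists; exists (query_time t1 t2 k (query_set V s a)).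
  by split; [constructor|exact: query_time_le|exact: H].
- have [s1 [k1 [e1 b1 /IH2[s2 [k2 [e2 b2 Q2]]]]]] := IH1 _ _ H.
  by exists s2, (k1 + k2)%N; split; [exact: exec_seq e1 e2|exact: leq_add|].
- suff [s1 [k [e bk Q1]]] : runs (if beval s b then c1 else c2) s
      (cost (Tind t1 t2) c1 + cost (Tind t1 t2) c2) Q.
    by exists s1, k.+1; split=> //; apply: exec_if.
  case: (beval s b) H => [/IH1|/IH2] [s1 [k [e bk Q1]]]; exists s1, k; split=> //.
    exact: leq_trans bk (leq_addr _ _).
  exact: leq_trans bk (leq_addl _ _).
Qed.

Lemma runs_seq c1 c2 s B1 B2 Q :
  runs c1 s B1 (fun s1 => runs c2 s1 B2 Q) -> runs (Seq c1 c2) s (B1 + B2) Q.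
Proof.
move=> [s1 [k1 [e1 b1 [s2 [k2 [e2 b2 Q2]]]]]].
by exists s2, (k1 + k2)%N; split; [exact: exec_seq e1 e2|exact: leq_add|].
Qed.

Lemma runs_mono c s B (Q Q' : state R -> Prop) :
  runs c s B Q -> (forall s', Q s' -> Q' s') -> runs c s B Q'.
Proof. by move=> [s' [k [e b /[swap] /[apply] Q1]]]; exists s', k. Qed.

End Hoare.

Local Notation num := NConst.
Local Notation cell a := (NGet a (num 0)).

(* Memory layout: the natural arrays used besides the input array 0. *)
Local Notation a_i := 1%N.      (* [0]: loop counter *)
Local Notation a_size0 := 2%N.  (* [0]: size of the initial common set *)
Local Notation a_set0 := 3%N.   (* the initial common independent set *)
Local Notation a_ans := 4%N.    (* [0]: oracle answer *)
Local Notation a_ord := 5%N.    (* elements by decreasing weight *)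
Local Notation a_pos := 6%N.    (* inverse of [a_ord] *)
Local Notation a_w := 7%N.      (* weights *)
Local Notation a_lev := 8%N.    (* [k]: number of elements of weight >= k *)
Local Notation a_I := 9%N.      (* greedy set of the first matroid *)
Local Notation a_J := 10%N.     (* greedy set of the second matroid *)
Local Notation a_size := 11%N.  (* [0]: size of the current greedy set *)
Local Notation a_cI := 12%N.    (* how many greedy sets contained v, *)
Local Notation a_cJ := 13%N.    (* for each of the two matroids *)
Local Notation a_t := 14%N.     (* [0]: iteration number *)
Local Notation a_v := 15%N.     (* [0]: current element *)
Local Notation a_ans' := 16%N.  (* [0]: second oracle answer *)
Local Notation a_p := 17%N.     (* [0]: target position of a move *)
Local Notation a_q := 18%N.     (* [0]: old position of the moved element *)
Local Notation a_u := 19%N.     (* [0]: element it is exchanged with *)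

(** * Loops over the ground set *)

Definition for_loop (c : cmd) : cmd :=
  Seq (NSet a_i (num 0) (num 0))
    (While (BNLt (cell a_i) (cell 0))
      (Seq c (NSet a_i (num 0) (NAdd (cell a_i) (num 1))))).

Definition set_i R (s : state R) (i : nat) : state R :=
  State (upd (nmem s) a_i 0 i) (rmem s).

(** Each round pays 2 for the test and the increment; the last 2 pays for the initialization and the
    failing test. [Inv] speaks of the state with the counter already set, hence [set_i]. *)
Lemma runs_for (R : realType) (V : finType) (M1 M2 : matroid V)
    (t1 t2 : {set V} -> nat) (Inv : nat -> state R -> Prop) (n b : nat) c
    (s : state R) Q :
  nmem s 0 0 = n -> Inv 0%N (set_i s 0) ->
  (forall i s, (i < n)%N -> nmem s a_i 0 = i -> nmem s 0 0 = n -> Inv i s ->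
    runs M1 M2 t1 t2 c s b (fun s' =>
      [/\ nmem s' a_i 0 = i, nmem s' 0 0 = n & Inv i.+1 (set_i s' i.+1)])) ->
  (forall s, nmem s 0 0 = n -> Inv n s -> Q s) ->
  runs M1 M2 t1 t2 (for_loop c) s (n * (b + 2) + 2) Q.
Proof.
move=> ns I0 step post.
have ->: (n * (b + 2) + 2 = 1 + (n * (b + 2) + 1))%N by lia.
apply: runs_seq; eexists; exists 1%N; split=> //; first exact: exec_nset.
have := I0; rewrite /set_i.
set s0 := State _ _; change (Inv 0%N s0 ->
  runs M1 M2 t1 t2 (While (BNLt (cell a_i) (cell 0))
      (Seq c (NSet a_i (num 0) (NAdd (cell a_i) (num 1))))) s0 (n * (b + 2) + 1) Q).
have s0i : nmem s0 a_i 0 = 0%N by [].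
have s0n : nmem s0 0 0 = n by [].
suff: forall m i s1, (m + i = n)%N -> nmem s1 a_i 0 = i -> nmem s1 0 0 = n ->
   Inv i s1 -> runs M1 M2 t1 t2 (While (BNLt (cell a_i) (cell 0))
      (Seq c (NSet a_i (num 0) (NAdd (cell a_i) (num 1))))) s1 (m * (b + 2) + 1) Q.
  by apply=> //; rewrite addn0.
elim=> [|m IH] i s1 /= mi s1i s1n Is1.
  exists s1, 1%N; split=> //; first by apply: exec_while_stop => /=; lia.
  by apply: post => //; rewrite -mi.
have lti : (i < n)%N by lia.
have mi' : (m + i.+1 = n)%N by lia.
have [s2 [k2 [e2 b2 [s2i s2n Is2]]]] := step i s1 lti s1i s1n Is1.
have [s3 [k3 [e3 b3 Q3]]] := IH i.+1 (set_i s2 i.+1) mi' erefl s2n Is2.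
exists s3, ((k2 + 1) + k3).+1; split=> //; last lia.
apply: exec_while_step e3; first by rewrite /=; lia.
apply: exec_seq e2 _.
have -> : set_i s2 i.+1 = State (upd (nmem s2) a_i (neval s2 (num 0))
   (neval s2 (NAdd (cell a_i) (num 1)))) (rmem s2) by rewrite /= s2i addn1.
exact: exec_nset.
Qed.

(** * Buckets *)

Definition update1 (f : nat -> nat) (i x : nat) : nat -> nat :=
  fun j => if j == i then x else f j.

(* [lev k] is the number of elements of weight at least k, for k > 0. *)
Definition sorted_by (n : nat) (ord pos w lev : nat -> nat) : Prop :=
  [/\ forall i, (i < n)%N -> (ord i < n)%N /\ pos (ord i) = i,
      forall v, (v < n)%N -> (pos v < n)%N /\ ord (pos v) = v,
      forall k, (0 < k)%N -> (lev k <= n)%N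
    & forall k i, (0 < k)%N -> (i < n)%N -> (i < lev k)%N = (k <= w (ord i))%N].

(** The outer write takes precedence, which keeps the exchange right when [v] already stands at
    position [p]. *)
Definition swap_ord (ord pos : nat -> nat) v p :=
  update1 (update1 ord (pos v) (ord p)) p v.
Definition swap_pos (ord pos : nat -> nat) v p :=
  update1 (update1 pos (ord p) (pos v)) v p.

Lemma swap_inverse n ord pos v p : (v < n)%N -> (p < n)%N ->
  (forall i, (i < n)%N -> (ord i < n)%N /\ pos (ord i) = i) ->
  (forall v, (v < n)%N -> (pos v < n)%N /\ ord (pos v) = v) ->
  let ord' := swap_ord ord pos v p in
  let pos' := swap_pos ord pos v p in
  (forall i, (i < n)%N -> (ord' i < n)%N /\ pos' (ord' i) = i) /\
  (forall v, (v < n)%N -> (pos' v < n)%N /\ ord' (pos' v) = v).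
Proof.
move=> vn pn ordP posP /=; rewrite /swap_ord /swap_pos /update1.
have [pv ov] := posP v vn; have [op pp] := ordP p pn.
split=> [i lti|u ltu].
  have [oi poi] := ordP i lti.
  case: (eqVneq i p) => [->|nip]; first by rewrite eqxx.
  case: (eqVneq i (pos v)) => [->|niv].
    by case: eqVneq => [E|_]; [rewrite -E pp | rewrite eqxx].
  case: eqVneq => [E|_]; first by move: niv; rewrite -E poi eqxx.
  by case: eqVneq => [E|_] //; move: nip; rewrite -poi E pp eqxx.
have [pu ou] := posP u ltu.
case: (eqVneq u v) => [->|nuv]; first by rewrite eqxx.
case: (eqVneq u (ord p)) => [E|nuo].
  by rewrite eqxx; case: (eqVneq (pos v) p) => [F|_];
    [move: nuv; rewrite E -F ov eqxx|rewrite E].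
case: eqVneq => [E|_]; first by move: nuo; rewrite -E ou eqxx.
by case: eqVneq => [E|_] //; move: nuv; rewrite -ou E ov eqxx.
Qed.

(** Weights decrease along [ord], so [p] is the first position of the class of [v]. Exchanging [v]
    with its occupant stays inside the class; the boundary then moves by one to take [v] into the
    next class. *)
Lemma sorted_incr n ord pos w lev v : sorted_by n ord pos w lev -> (v < n)%N ->
  let p := lev (w v).+1 in
  sorted_by n (swap_ord ord pos v p) (swap_pos ord pos v p)
    (update1 w v (w v).+1) (update1 lev (w v).+1 p.+1).
Proof.
move=> [ordP posP lev_n levP] vn p; have [pv ov] := posP v vn.
have lpv : (p <= pos v)%N by rewrite leqNgt levP // ov ltnn.
have pn : (p < n)%N by exact: leq_ltn_trans pv.
have [opn pop] := ordP p pn.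
(* [p] lies between the boundary [lev (w v).+1] and [pos v], hence in the class of [v]. *)
have wu : w (ord p) = w v.
  apply/eqP; rewrite eqn_leq; apply/andP; split.
    by rewrite leqNgt -levP // ltnn.
  case E: (w v) => [//|k]; rewrite -E -levP ?E //.
  by apply: leq_ltn_trans lpv _; rewrite levP ?ov ?E.
have [ordP' posP'] := swap_inverse vn pn ordP posP.
split=> // [k k0|k i k0 lti]; rewrite /swap_ord /update1.
  by case: eqP => // _; apply: lev_n.
have := levP k i k0 lti; have := levP k p k0 pn; have := levP k (pos v) k0 pv.
have [_ ] := ordP i lti; rewrite ov wu.
case: (eqVneq i p) => [->|nip].
  rewrite eqxx; case: (eqVneq k (w v).+1) => [->|]; lia.
case: (eqVneq i (pos v)) => [Ei|niv].
  have nov : ord p != v by apply: contra_neq nip => E; rewrite Ei -E pop.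
  rewrite (negPf nov) wu; case: (eqVneq k (w v).+1) => [->|]; lia.
have nov : ord i != v by apply/eqP => E; move: niv; rewrite -E (ordP i lti).2 eqxx.
rewrite (negPf nov); case: (eqVneq k (w v).+1) => [->|]; lia.
Qed.

(** Dually, [p] is the last position of the class of [v], and the boundary moves back to release
    [v]. *)
Lemma sorted_decr n ord pos w lev v : sorted_by n ord pos w lev -> (v < n)%N ->
  (0 < w v)%N ->
  let p := (lev (w v) - 1)%N in
  sorted_by n (swap_ord ord pos v p) (swap_pos ord pos v p)
    (update1 w v (w v - 1)%N) (update1 lev (w v) p).
Proof.
move=> [ordP posP lev_n levP] vn w0 p; have [pv ov] := posP v vn.
have lpv : (pos v < lev (w v))%N by rewrite levP // ov.
have := lev_n _ w0 => lev_wv.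
have lpv' : (pos v <= p)%N by rewrite /p; lia.
have pn : (p < n)%N by rewrite /p; lia.
have plev : (p < lev (w v))%N by rewrite /p; lia.
have [opn pop] := ordP p pn.
have wu : w (ord p) = w v.
  apply/eqP; rewrite eqn_leq; apply/andP; split; last by rewrite -levP.
  rewrite leqNgt -levP // -leqNgt; apply: leq_trans lpv'.
  by rewrite leqNgt levP // ov ltnn.
have [ordP' posP'] := swap_inverse vn pn ordP posP.
split=> // [k k0|k i k0 lti]; rewrite /swap_ord /update1.
  by case: eqP => [_|_]; [rewrite ltnW|apply: lev_n].
have := levP k i k0 lti; have := levP k p k0 pn; have := levP k (pos v) k0 pv.
have [_ ] := ordP i lti; rewrite ov wu.
case: (eqVneq i p) => [->|nip].
  by rewrite eqxx; case: (eqVneq k (w v)) => [->|]; lia.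
case: (eqVneq i (pos v)) => [Ei|niv].
  have nov : ord p != v by apply: contra_neq nip => E; rewrite Ei -E pop.
  by rewrite (negPf nov) wu; case: (eqVneq k (w v)) => [->|]; lia.
have nov : ord i != v by apply/eqP => E; move: niv; rewrite -E (ordP i lti).2 eqxx.
by rewrite (negPf nov); case: (eqVneq k (w v)) => [->|]; lia.
Qed.

(** * Convergence *)

(** One coordinate of a unit subgradient step, projected onto the interval from 0 to [K]; the
    predecessor stops at 0 by itself. *)
Definition move_weight (K w : nat) (bI bJ : bool) : nat :=
  if bI then (if bJ then w else w.-1)
  else if bJ && (w < K)%N then w.+1 else w.

(** The competitor's coordinate is [K] if [b] holds and 0 otherwise. *)
Definition sqdist (K w : nat) (b : bool) : nat :=
  ((if b then K - w else w) ^ 2)%N.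

Lemma move_weight_le K w bI bJ : (w <= K -> move_weight K w bI bJ <= K)%N.
Proof. by rewrite /move_weight; case: bI; case: bJ => /=; case: ltnP; lia. Qed.

(** Expand the square for the unprojected step: its quadratic term is at most [bI + bJ], and
    projecting only brings the weight closer to the competitor. *)
Lemma sqdist_move K w (b bI bJ : bool) : (w <= K)%N ->
  (sqdist K (move_weight K w bI bJ) b + 2 * (bI * w + bJ * (K - w))
   <= sqdist K w b + 2 * K * (if b then bI else bJ) + (bI + bJ))%N.
Proof.
rewrite /sqdist /move_weight => wK.
case: bI; case: bJ => /=.
- by case: b; nia.
- case: w wK => [|w] wK; case: b => /=; rewrite ?mul1n ?mul0n ?addn0.
  + by rewrite subn0; lia.
  + by lia.
  + have -> : (K - w = (K - w.+1).+1)%N by lia.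
    by move: (K - w.+1)%N (subnK wK) => d dE; rewrite -dE; nia.
  + by nia.
- case: ltnP => wK'; case: b => /=; rewrite ?mul1n ?mul0n ?addn0 ?add0n.
  + have -> : (K - w = (K - w.+1).+1)%N by lia.
    by nia.
  + by move: (subnK wK); move: (K - w)%N => d dE; rewrite -dE; nia.
  + by (have -> : K = w by lia); nia.
  + by (have -> : K = w by lia); nia.
- by case: b; lia.
Qed.

Section Potential.
Variables (V : finType) (M1 M2 : matroid V) (K cap : nat).
Local Notation r := (max_common M1 M2).

(* Regret inequality of projected subgradient descent on [0, K]^V, against the
   fixed competitor K * [U]; the weights are the iterates. *)
Definition regret_bound (t : nat) (w cI cJ : V -> nat) : Prop :=
  forall U : {set V},
   (2 * K * r * t + \sum_x sqdist K (w x) (x \in U)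
    <= 2 * K * (\sum_x (if x \in U then cI x else cJ x))
       + #|V| * K ^ 2 + 2 * cap * t)%N.

Lemma regret_bound0 : regret_bound 0 (fun=> 0%N) (fun=> 0%N) (fun=> 0%N).
Proof.
move=> U; rewrite !muln0 addn0 add0n -sum_nat_const.
apply: leq_trans (leq_addl _ _); apply: leq_sum => x _.
by rewrite /sqdist; case: (x \in U); rewrite ?subn0 // exp0n.
Qed.

(** The coordinate inequalities are summed. A largest common independent set [O] is a candidate for
    both greedy choices, and [w] and [K - w] add up to [K], so the two greedy weights total at least
    [K * r]. By truncation the quadratic terms sum to at most [2 * cap]. *)
Lemma regret_bound_step t (w cI cJ keyI keyJ : V -> nat) (I J : {set V}) :
  regret_bound t w cI cJ -> (r <= cap)%N -> (forall x, w x <= K)%N ->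
  greedy_set (trunc M1 cap) keyI I -> greedy_set (trunc M2 cap) keyJ J ->
  (forall x y, (keyI y < keyI x)%N -> (w x <= w y)%N) ->
  (forall x y, (keyJ y < keyJ x)%N -> (w y <= w x)%N) ->
  regret_bound t.+1 (fun x => move_weight K (w x) (x \in I) (x \in J))
    (fun x => cI x + (x \in I))%N (fun x => cJ x + (x \in J))%N.
Proof.
move=> reg rcap wK gI gJ monoI monoJ U.
have [O [o1 o2 Or]] := max_common_witness M1 M2.
have oI : O \in indep (trunc M1 cap) by rewrite inE o1 Or.
have oJ : O \in indep (trunc M2 cap) by rewrite inE o2 Or.
have wI := greedy_weight_ge gI oI monoI.
have wJ : (\sum_(x in O) (K - w x) <= \sum_(x in J) (K - w x))%N.
  by apply: greedy_weight_ge gJ oJ _ => x y /monoJ le; rewrite leq_sub2l.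
have wO : (\sum_(x in O) w x + \sum_(x in O) (K - w x) = K * r)%N.
  rewrite -big_split /= -Or mulnC -sum_nat_const.
  by apply: eq_bigr => x _; rewrite subnKC.
have cardI := trunc_card gI.1; have cardJ := trunc_card gJ.1.
have indE (S : {set V}) (F : V -> nat) :
    (\sum_(x in S) F x = \sum_x (x \in S) * F x)%N.
  by rewrite big_mkcond; apply: eq_bigr => x _; case: (x \in S); rewrite ?mul1n.
have cardE (S : {set V}) : (#|S| = \sum_x (x \in S : nat))%N.
  by rewrite -sum1_card indE; apply: eq_bigr => x _; rewrite muln1.
rewrite !indE in wI wJ wO; rewrite !cardE in cardI cardJ.
have := leq_sum (P := xpredT) (index_enum V) (fun x _ =>
  @sqdist_move K (w x) (x \in U) (x \in I) (x \in J) (wK x)).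
rewrite !big_split /= big1_eq -big_distrr /= => pt.
have := reg U.
have -> : (\sum_x (if x \in U then cI x + (x \in I) else cJ x + (x \in J)) =
   \sum_x (if x \in U then cI x else cJ x) +
   \sum_x ((if x \in U then x \in I else x \in J) : bool))%N.
  by rewrite -big_split /=; apply: eq_bigr => x _; case: (x \in U).
rewrite mulnDr; have -> : (2 * K * r * t.+1 = 2 * K * r * t + 2 * (K * r))%N.
  by rewrite mulnS addnC mulnA.
rewrite -wO mulnS; move: wI wJ cardI cardJ pt; rewrite addn0.
do 10?[move: (bigop.body _ _ _) => ?].
move: (2 * K * r * t)%N (2 * cap * t)%N (#|V| * _)%N => ? ? ?.
by do 2!move: (2 * K * _)%N => ?; lia.
Qed.

End Potential.

(** Dividing the regret bound by [2 * K * t] leaves the errors [n * K / (2 * t)] and [2 * r0 / K].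
    The first is at most [eps * r / 2] by [K * eps <= 5] and the stopping test, the second by
    [4 <= K * eps]. *)
Lemma regret_value (R : realType) (n r r0 K t S : nat) (eps : R) :
  0 < eps -> 4 <= K%:R * eps -> K%:R * eps <= 5 -> (r0 <= r)%N -> (0 < t)%N ->
  5 * n%:R <= t%:R * r0%:R * eps ^+ 2 ->
  (2 * K * r * t <= 2 * K * S + n * K ^ 2 + 2 * (r0 + r0) * t)%N ->
  (1 - eps) * r%:R <= S%:R / t%:R.
Proof.
move=> eps0 K4 K5 r0r t0 big reg.
have t0' : 0 < t%:R :> R by rewrite ltr0n.
rewrite ler_pdivlMr //.
have r0r' : r0%:R <= r%:R :> R by rewrite ler_nat.
have r00 : 0 <= r0%:R :> R by [].
have {}reg : 2 * K%:R * r%:R * t%:R <= 2 * K%:R * S%:R + n%:R * K%:R ^+ 2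
    + 2 * (r0%:R + r0%:R) * t%:R :> R.
  by rewrite -?natrX -?natrM -?natrD -?natrM -?natrD -?natrM ler_nat.
have K0 : 0 < K%:R :> R by rewrite -(pmulr_lgt0 _ eps0); lra.
have nK : n%:R * K%:R <= t%:R * r0%:R * eps.
  rewrite -(ler_pM2r eps0); apply: le_trans (_ : 5 * n%:R <= _).
    by rewrite -mulrA mulrC ler_wpM2r.
  by rewrite (le_trans big) // expr2 !mulrA.
have nK' : n%:R * K%:R ^+ 2 <= t%:R * r%:R * eps * K%:R.
  rewrite expr2 mulrA ler_wpM2r ?(ltW K0) //; apply: le_trans nK _.
  by rewrite ler_wpM2r ?(ltW eps0) // ler_wpM2l ?(ltW t0').
have rt : 4 * (r0%:R * t%:R) <= (K%:R * eps) * (r%:R * t%:R).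
  apply: ler_pM => //; first exact: mulr_ge0.
  by rewrite ler_wpM2r ?(ltW t0').
by rewrite -(ler_pM2l (_ : 0 < 2 * K%:R)) ?mulr_gt0 //; lra.
Qed.

(** * The program *)

Definition init_step : cmd :=
  Seq (NSet a_ord (cell a_i) (cell a_i))
  (Seq (NSet a_pos (cell a_i) (cell a_i))
  (Seq (NSet a_set0 (cell a_i) (num 1))
  (Seq (Query false a_set0 a_ans)
  (Seq (Query true a_set0 a_ans')
  (If (BAnd (BNEq (cell a_ans) (num 1)) (BNEq (cell a_ans') (num 1)))
      (NSet a_size0 (num 0) (NAdd (cell a_size0) (num 1)))
      (NSet a_set0 (cell a_i) (num 0))))))).

Local Notation greedy_arr k := (if k then a_J else a_I).

(* Truncation to rank [2 * size0]; the second matroid sees the reverse order. *)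
Definition greedy_step (k : bool) : cmd :=
  Seq (NSet a_v (num 0)
        (NGet a_ord (if k then NSub (NSub (cell 0) (num 1)) (cell a_i)
                     else cell a_i)))
  (Seq (NSet (greedy_arr k) (cell a_v) (num 1))
  (Seq (Query k (greedy_arr k) a_ans)
  (If (BAnd (BNEq (cell a_ans) (num 1))
            (BNLt (cell a_size) (NAdd (cell a_size0) (cell a_size0))))
      (NSet a_size (num 0) (NAdd (cell a_size) (num 1)))
      (NSet (greedy_arr k) (cell a_v) (num 0))))).

Definition greedy (k : bool) : cmd :=
  Seq (NSet a_size (num 0) (num 0)) (for_loop (greedy_step k)).

Definition swap_to_p : cmd :=
  Seq (NSet a_q (num 0) (NGet a_pos (cell a_i)))
  (Seq (NSet a_u (num 0) (NGet a_ord (cell a_p)))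
  (Seq (NSet a_ord (cell a_q) (cell a_u))
  (Seq (NSet a_ord (cell a_p) (cell a_i))
  (Seq (NSet a_pos (cell a_u) (cell a_q))
       (NSet a_pos (cell a_i) (cell a_p)))))).

Local Notation weight_i := (NGet a_w (cell a_i)).

(** The level cell is addressed through the old weight, so the weight is written last. *)
Definition increase_weight : cmd :=
  Seq (NSet a_p (num 0) (NGet a_lev (NAdd weight_i (num 1))))
  (Seq swap_to_p
  (Seq (NSet a_lev (NAdd weight_i (num 1)) (NAdd (cell a_p) (num 1)))
       (NSet a_w (cell a_i) (NAdd weight_i (num 1))))).

Definition decrease_weight : cmd :=
  Seq (NSet a_p (num 0) (NSub (NGet a_lev weight_i) (num 1)))
  (Seq swap_to_p
  (Seq (NSet a_lev weight_i (cell a_p))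
       (NSet a_w (cell a_i) (NSub weight_i (num 1))))).

(** [K] is never computed: comparing 4 with the weight times [eps] decides whether the weight has
    reached [K]. *)
Definition reweight : cmd :=
  If (BNEq (NGet a_I (cell a_i)) (num 1))
    (If (BNEq (NGet a_J (cell a_i)) (num 1)) Skip
      (If (BNLt (num 0) weight_i) decrease_weight Skip))
    (If (BNEq (NGet a_J (cell a_i)) (num 1))
      (If (BRLe (ROfNat (num 4)) (RMul (ROfNat weight_i) (RGet 0 (num 0))))
         Skip increase_weight) Skip).

(** The output is rewritten in every iteration, so it is current whenever the loop stops. The greedy
    sets are cleared for the next iteration. *)
Definition record_step : cmd :=
  Seq (NSet a_cI (cell a_i) (NAdd (NGet a_cI (cell a_i)) (NGet a_I (cell a_i))))
  (Seq (NSet a_cJ (cell a_i) (NAdd (NGet a_cJ (cell a_i)) (NGet a_J (cell a_i))))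
  (Seq (NSet a_I (cell a_i) (num 0))
  (Seq (NSet a_J (cell a_i) (num 0))
  (If (BNLt (NGet a_cI (cell a_i)) (NGet a_cJ (cell a_i)))
     (RSet 1 (cell a_i) (RDiv (ROfNat (NGet a_cI (cell a_i))) (ROfNat (cell a_t))))
     (RSet 1 (cell a_i)
        (RDiv (ROfNat (NGet a_cJ (cell a_i))) (ROfNat (cell a_t)))))))).

(** The loop is skipped if the initial common set is empty, so that [r = 0], or if [eps >= 1]; the
    zero vector then suffices. Otherwise it ends when [t * r0 * eps ^ 2] reaches [5 * n], where [r0]
    is the size of that set. *)
Definition algorithm : iterative_algorithm :=
  IterAlg (for_loop init_step)
   (BAnd (BNLt (num 0) (cell a_size0))
     (BAnd (BNot (BRLe (ROfNat (num 1)) (RGet 0 (num 0))))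
       (BNot (BRLe (RMul (ROfNat (num 5)) (ROfNat (cell 0)))
          (RMul (RMul (ROfNat (cell a_t)) (ROfNat (cell a_size0)))
                (RMul (RGet 0 (num 0)) (RGet 0 (num 0))))))))
   (Seq (NSet a_t (num 0) (NAdd (cell a_t) (num 1)))
   (Seq (greedy false)
   (Seq (greedy true)
        (for_loop (Seq reweight record_step))))).

(** * Correctness of the program *)

Section Correctness.
Variables (R : realType) (V : finType) (M1 M2 : matroid V).
Variables (t1 t2 : {set V} -> nat).
Local Notation n := #|V|.
Local Notation T := (Tind t1 t2).
Local Notation run_cmd := (runs M1 M2 t1 t2).
Implicit Types (s : state R) (S : {set V}) (x y : V) (f : nat -> nat).

(** Entries are exactly 0 or 1, since they are also added to the counters. *)
Definition codes f S : Prop := forall x, f (enum_rank x) = (x \in S).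

Lemma codes_set1 f S x : codes f S -> codes (update1 f (enum_rank x) 1) (x |: S).
Proof.
move=> fS y; rewrite /update1 !inE (inj_eq val_inj) (inj_eq enum_rank_inj).
by case: eqP.
Qed.

Lemma codes_reset f S x : codes f S -> x \notin S ->
  codes (update1 (update1 f (enum_rank x) 1) (enum_rank x) 0) S.
Proof.
move=> fS /negPf xS y; rewrite /update1 (inj_eq val_inj) (inj_eq enum_rank_inj).
by case: eqP => [->|]; rewrite ?xS.
Qed.

Lemma codes_query s a S : codes (nmem s a) S -> query_set V s a = S.
Proof. by move=> fS; apply/setP => x; rewrite inE fS; case: (x \in S). Qed.

Lemma rank_of i : (i < n)%N -> exists x, enum_rank x = i :> nat.
Proof. by move=> lti; exists (enum_val (Ordinal lti)); rewrite enum_valK. Qed.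

Definition frame (arrays : seq nat) (s s' : state R) : Prop :=
  forall b j, b \notin arrays -> nmem s' b j = nmem s b j.

Lemma init_spec (eps : R) :
  run_cmd (for_loop init_step) (input_state V eps)
    (n * ((2 * T + 6) + 2) + 2) (fun s => exists S,
    [/\ [/\ S \in indep M1, S \in indep M2, nmem s a_size0 0 = #|S|
          & forall x, x \notin S ->
              ~~ ((x |: S \in indep M1) && (x |: S \in indep M2))],
        forall j, (j < n)%N -> nmem s a_ord j = j /\ nmem s a_pos j = j,
        forall b j, (a_w <= b)%N -> b != a_ans' -> nmem s b j = 0%N,
        nmem s 0 0 = n
      & rmem s = rmem (input_state V eps)]).
Proof.
pose Inv i s := exists S,
    [/\ [/\ S \in indep M1, S \in indep M2, nmem s a_size0 0 = #|S|,
          codes (nmem s a_set0) S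
          & forall x, x \in S -> (enum_rank x < i)%N],
        forall x, (enum_rank x < i)%N -> x \notin S ->
              ~~ ((x |: S \in indep M1) && (x |: S \in indep M2)),
        forall j, (j < i)%N -> nmem s a_ord j = j /\ nmem s a_pos j = j,
        forall b j, (a_w <= b)%N -> b != a_ans' -> nmem s b j = 0%N
      & rmem s = rmem (input_state V eps)].
apply: (@runs_for _ _ _ _ _ _ Inv n).
- by [].
- exists set0; split=> //.
  + by split; rewrite ?indep0 ?cards0 //= => x; rewrite inE.
  + by move=> [|[|b]] j // _ _; rewrite /= /upd.
- move=> i s lti si sn [S [[i1 i2 sz cod ltS] maxS ordS zero rm]].
  have [x xi] := rank_of lti.
  have xS : x \notin S by apply/negP => /ltS; rewrite xi ltnn.
  apply: runs_wp; last by rewrite /=; lia.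
  rewrite /= /upd /= !si.
  have codS := codes_set1 x cod; rewrite -xi.
  rewrite (@codes_query _ _ (x |: S)); last exact: codS.
  rewrite (@codes_query _ _ (x |: S)); last exact: codS.
  rewrite xi /oracle.
  have ordS' j : (j < i.+1)%N ->
      (if j == i then i else nmem s a_ord j) = j /\
      (if j == i then i else nmem s a_pos j) = j.
    by rewrite ltnS leq_eqVlt; case: eqP => [->|_] //= /ordS.
  rewrite !eqb1; case: ifPn => [/andP[j1 j2]|no]; split=> //.
    exists (x |: S); split=> //=.
    + split=> //=; first by rewrite cardsU1 xS sz addnC.
        by rewrite -xi; exact: codS.
      by move=> y /setU1P[->|/ltS]; rewrite ?xi ltnS // => /ltnW.
    + move=> y; rewrite ltnS leq_eqVlt => /orP[/eqP yi|lty].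
        by move/eqP: yi; rewrite -xi (inj_eq val_inj) (inj_eq enum_rank_inj)
          => /eqP ->; rewrite !inE eqxx.
      (* A rejection persists as the set grows, since independence passes to subsets. *)
      rewrite !inE negb_or => /andP[_ yS]; apply: contra (maxS y lty yS).
      by move=> /andP[k1 k2]; rewrite (indepS _ k1) ?(indepS _ k2) // setUS ?subsetUr.
    + move=> b j bw b16; rewrite /upd; do ?(case: (b =P _) => /= [E|_]; first by lia).
      exact: zero.
  exists S; split=> //=.
  + split=> //=; last by move=> y /ltS; rewrite ltnS => /ltnW.
    by rewrite -xi; apply: codes_reset.
  + move=> y; rewrite ltnS leq_eqVlt => /orP[/eqP yi|lty]; last exact: maxS.
    by move/eqP: yi; rewrite -xi (inj_eq val_inj) (inj_eq enum_rank_inj) => /eqP ->.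
  + move=> b j bw b16; rewrite /upd; do ?(case: (b =P _) => /= [E|_]; first by lia).
    exact: zero.
- move=> s sn [S [[i1 i2 sz _ ltS] maxS ordS zero rm]]; exists S; split=> //.
  split=> // x; exact: maxS.
Qed.

(** * The greedy phase *)

Definition key (k : bool) (pos : nat -> nat) x : nat :=
  if k then (n - 1 - pos (enum_rank x))%N else pos (enum_rank x).

Lemma key_ex k ord pos w lev i : sorted_by n ord pos w lev -> (i < n)%N ->
  exists2 x, key k pos x = i
    & enum_rank x = ord (if k then n - 1 - i else i)%N :> nat.
Proof.
move=> [ordP _ _ _] lti; set j := (if k then _ else _).
have ltj : (j < n)%N by rewrite /j; case: (k); lia.
have [oj pj] := ordP j ltj; have [x xj] := rank_of oj; exists x => //.
by rewrite /key xj pj /j; case: (k); lia.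
Qed.

Lemma key_inj k ord pos w lev x y : sorted_by n ord pos w lev ->
  key k pos x = key k pos y -> x = y.
Proof.
move=> [_ posP _ _]; have [px ox] := posP _ (ltn_ord (enum_rank x)).
have [py oy] := posP _ (ltn_ord (enum_rank y)); rewrite /key => E.
apply/enum_rank_inj/val_inj; rewrite /= -ox -oy; congr ord.
by case: k E; lia.
Qed.

Lemma key_lt k ord pos w lev x : sorted_by n ord pos w lev -> (key k pos x < n)%N.
Proof.
move=> [_ posP _ _]; have [px ox] := posP _ (ltn_ord (enum_rank x)).
by rewrite /key; case: k; lia.
Qed.

(** A rejected element is blocked by the accepted elements of smaller key; those accepted later have
    larger keys and leave this set unchanged. The size counter implements the truncation. *)
Lemma greedy_spec k s lev :
  nmem s 0 0 = n -> codes (nmem s (greedy_arr k)) set0 ->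
  sorted_by n (nmem s a_ord) (nmem s a_pos) (nmem s a_w) lev ->
  run_cmd (greedy k) s (n * (T + 8) + 3) (fun s' => exists S,
    [/\ codes (nmem s' (greedy_arr k)) S,
        greedy_set (trunc (if k then M2 else M1) (nmem s a_size0 0 + nmem s a_size0 0))
          (key k (nmem s a_pos)) S,
        frame [:: a_i; a_ans; a_size; a_v; greedy_arr k] s s'
      & rmem s' = rmem s]).
Proof.
move=> sn cod0 srt; set pos := nmem s a_pos in srt *; set M := trunc _ _.
have -> : (n * (T + 8) + 3 = 1 + (n * (T + 6 + 2) + 2))%N by lia.
apply: runs_seq; apply: runs_wp => //=.
pose Inv i s1 := exists S,
  [/\ [/\ S \in indep M, nmem s1 a_size 0 = #|S|, codes (nmem s1 (greedy_arr k)) S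
         & forall x, x \in S -> (key k pos x < i)%N],
      forall x, (key k pos x < i)%N -> x \notin S ->
        x |: [set y in S | (key k pos y < key k pos x)%N] \notin indep M,
      frame [:: a_i; a_ans; a_size; a_v; greedy_arr k] s s1
    & rmem s1 = rmem s].
apply: (@runs_for _ _ _ _ _ _ Inv n) => //.
- exists set0; split=> //.
  + split; rewrite ?indep0 ?cards0 //; last by move=> x; rewrite inE.
    by case: k {srt Inv M} cod0.
  + move=> b j; rewrite !inE !negb_or => /and5P[b1 b4 b11 b15 bk].
    by rewrite /= /upd (negPf b1) (negPf b11).
- move=> i s1 lti si s1n [S [[iS sz cod ltS] maxS fr rm]].
  have [x kx xi] := key_ex k srt lti.
  have xS : x \notin S by apply/negP => /ltS; rewrite kx ltnn.
  have ordE : nmem s1 a_ord (if k then n - 1 - i else i)%N = enum_rank x.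
    by rewrite xi; apply: fr; case: (k).
  have size0E : nmem s1 a_size0 0 = nmem s a_size0 0 by apply: fr; case: (k).
  apply: runs_wp; last by rewrite /=; lia.
  have codS := codes_set1 x cod.
  rewrite /=.
  have -> : neval s1 (if k then NSub (NSub (cell 0) (num 1)) (cell a_i) else cell a_i)
     = (if k then n - 1 - i else i)%N by case: (k); rewrite /= si ?s1n.
  rewrite ordE /upd; set arr := (if k then _ else _) in cod cod0 fr codS *.
  have arrE : ((15 == arr) = false)%N * ((4 == arr) = false)%N *
      ((11 == arr) = false)%N * ((2 == arr) = false)%N * ((0 == arr) = false)%N *
      ((1 == arr) = false)%N * ((arr == 1) = false)%N * ((arr == 4) = false)%N *
      ((arr == 11) = false)%N * ((arr == 15) = false)%N by rewrite /arr; case: (k).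
  rewrite /= !arrE /= (@codes_query _ _ (x |: S)); last first.
    by move=> y /=; rewrite eqxx arrE -codS.
  rewrite eqb1 /oracle sz size0E -trunc_setU1 // si s1n.
  have newx y : (key k pos y < i.+1)%N -> y = x \/ (key k pos y < i)%N.
    rewrite ltnS leq_eqVlt => /predU1P[ky|]; [left|by right].
    by apply: (@key_inj k _ _ _ _ _ _ srt); rewrite kx.
  case: ifPn => [iSx|niSx]; split=> //.
    exists (x |: S); split=> //=.
    + split; [exact: iSx|by rewrite /= cardsU1 xS addnC| |].
        by move=> y; rewrite -codS /upd /update1 !arrE eqxx.
      by move=> y /setU1P[->|/ltS]; rewrite ?kx // ltnS => /ltnW.
    + move=> y /newx[->|lty]; first by rewrite !inE eqxx.
      rewrite in_setU1 negb_or => /andP[_ yS].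
      have -> : [set z in x |: S | (key k pos z < key k pos y)%N] =
          [set z in S | (key k pos z < key k pos y)%N]; last exact: maxS.
      apply/setP=> z; rewrite !inE.
      by case: eqP => [->|//]; rewrite kx (negPf xS) ltnNge ltnW.
    + move=> b j bn; rewrite -fr //; move: bn; rewrite !inE !negb_or /= /upd.
      by move=> /and5P[/negPf-> /negPf-> /negPf-> /negPf-> /negPf->].
  exists S; split=> //=.
  + split; [exact: iS|by rewrite /= /upd /= arrE| |]; last first.
      by move=> y /ltS; rewrite ltnS => /ltnW.
    move=> y; rewrite /= -(codes_reset cod xS y) /upd /update1 !arrE eqxx /=.
    by case: eqP.
  + move=> y /newx[->|]; last exact: maxS.
    (* At the moment of rejection every accepted element has a smaller key. *)
    move=> _; rewrite kx; suff -> : [set y in S | (key k pos y < i)%N] = S by [].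
    by apply/setP=> z; rewrite !inE; apply/andb_idr/ltS.
  + move=> b j bn; rewrite -fr //; move: bn; rewrite !inE !negb_or /= /upd.
    by move=> /and5P[/negPf-> /negPf-> _ /negPf-> /negPf->].
- move=> s1 s1n [S [[iS sz cod ltS] maxS fr rm]]; exists S; split=> //.
  split=> // x xS; apply: maxS => //; exact: key_lt srt.
Qed.

(** * Weight updates and counters *)

Definition sorted_state s : Prop :=
  sorted_by n (nmem s a_ord) (nmem s a_pos) (nmem s a_w) (nmem s a_lev).

(* Naming the values keeps the terms describing the memory of linear size. *)
Lemma wp_nset a i e iv ev s Q : neval s i = iv -> neval s e = ev ->
  Q (State (upd (nmem s) a iv ev) (rmem s)) -> wp M1 M2 (NSet a i e) s Q.
Proof. by move=> <- <-. Qed.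

Lemma wp_nset_seq a i e c iv ev s Q : neval s i = iv -> neval s e = ev ->
  wp M1 M2 c (State (upd (nmem s) a iv ev) (rmem s)) Q ->
  wp M1 M2 (Seq (NSet a i e) c) s Q.
Proof. by move=> <- <-. Qed.

Lemma wp_seq c1 c2 s Q :
  wp M1 M2 c1 s (fun s1 => wp M1 M2 c2 s1 Q) -> wp M1 M2 (Seq c1 c2) s Q.
Proof. by []. Qed.

Lemma wp_swap s Q v p : nmem s a_i 0 = v -> nmem s a_p 0 = p ->
  (forall s', nmem s' a_ord = swap_ord (nmem s a_ord) (nmem s a_pos) v p ->
     nmem s' a_pos = swap_pos (nmem s a_ord) (nmem s a_pos) v p ->
     frame [:: a_ord; a_pos; a_q; a_u] s s' -> rmem s' = rmem s -> Q s') ->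
  wp M1 M2 swap_to_p s Q.
Proof.
move=> sv sp post; rewrite /swap_to_p.
refine (wp_nset_seq (iv := 0%N) (ev := nmem s a_pos v) _ _ _) => [//||].
  by rewrite /= sv.
refine (wp_nset_seq (iv := 0%N) (ev := nmem s a_ord p) _ _ _) => [//||].
  by rewrite /= /upd /= sp.
refine (wp_nset_seq (iv := nmem s a_pos v) (ev := nmem s a_ord p) _ _ _) => [//|//|].
refine (wp_nset_seq (iv := p) (ev := v) _ _ _) => [//|//|].
refine (wp_nset_seq (iv := nmem s a_ord p) (ev := nmem s a_pos v) _ _ _) => [//|//|].
refine (wp_nset (iv := v) (ev := p) _ _ _) => [//|//|].
apply: post => //.
move=> b j; rewrite !inE !negb_or => /and4P[/negPf b5 /negPf b6 /negPf b18 /negPf b19].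
by rewrite /= /upd b5 b6 b18 b19.
Qed.

Lemma wp_increase s Q i w :
  nmem s a_i 0 = i -> nmem s a_w i = w -> (i < n)%N -> sorted_state s ->
  (forall s', sorted_state s' -> nmem s' a_w = update1 (nmem s a_w) i w.+1 ->
     frame [:: a_ord; a_pos; a_w; a_lev; a_p; a_q; a_u] s s' ->
     rmem s' = rmem s -> Q s') ->
  wp M1 M2 increase_weight s Q.
Proof.
move=> si sw lti srt post; rewrite /increase_weight; set p := nmem s a_lev w.+1.
refine (wp_nset_seq (iv := 0%N) (ev := p) _ _ _) => [//||].
  by rewrite /= si sw addn1.
refine (wp_seq _); set s0 := State _ _.
have s0i : nmem s0 a_i 0 = i by [].
have s0p : nmem s0 a_p 0 = p by [].
refine (wp_swap s0i s0p _) => s1 s1o s1p fr rm.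
have s1i : nmem s1 a_i 0 = i by rewrite fr.
have s1w : nmem s1 a_w = nmem s a_w by apply: boolp.funext => j; rewrite fr.
have s1l : nmem s1 a_lev = nmem s a_lev by apply: boolp.funext => j; rewrite fr.
refine (wp_nset_seq (iv := w.+1) (ev := p.+1) _ _ _).
- by rewrite /= s1i s1w sw addn1.
- by rewrite /= fr //= addn1.
refine (wp_nset (iv := i) (ev := w.+1) _ _ _) => [//||].
  by rewrite /= /upd /= s1i s1w sw addn1.
apply: post.
- have := sorted_incr srt lti; rewrite sw /sorted_state /= /upd /=.
  by rewrite s1o s1p s1w s1l.
- by rewrite /= /upd /= s1w.
- move=> b j; rewrite !inE !negb_or => /and5P[b5 b6 b7 b8 /and3P[b17 b18 b19]].
  rewrite /= /upd (negPf b7) (negPf b8) fr /= /upd ?(negPf b17) //.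
  by rewrite !inE !negb_or b5 b6 b18 b19.
- by rewrite rm.
Qed.

Lemma wp_decrease s Q i w :
  nmem s a_i 0 = i -> nmem s a_w i = w -> (0 < w)%N -> (i < n)%N ->
  sorted_state s ->
  (forall s', sorted_state s' -> nmem s' a_w = update1 (nmem s a_w) i (w - 1)%N ->
     frame [:: a_ord; a_pos; a_w; a_lev; a_p; a_q; a_u] s s' ->
     rmem s' = rmem s -> Q s') ->
  wp M1 M2 decrease_weight s Q.
Proof.
move=> si sw w0 lti srt post; rewrite /decrease_weight.
set p := (nmem s a_lev w - 1)%N.
refine (wp_nset_seq (iv := 0%N) (ev := p) _ _ _) => [//||].
  by rewrite /= si sw.
refine (wp_seq _); set s0 := State _ _.
have s0i : nmem s0 a_i 0 = i by [].
have s0p : nmem s0 a_p 0 = p by [].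
refine (wp_swap s0i s0p _) => s1 s1o s1p fr rm.
have s1i : nmem s1 a_i 0 = i by rewrite fr.
have s1w : nmem s1 a_w = nmem s a_w by apply: boolp.funext => j; rewrite fr.
have s1l : nmem s1 a_lev = nmem s a_lev by apply: boolp.funext => j; rewrite fr.
refine (wp_nset_seq (iv := w) (ev := p) _ _ _).
- by rewrite /= s1i s1w sw.
- by rewrite /= fr.
refine (wp_nset (iv := i) (ev := (w - 1)%N) _ _ _) => [//||].
  by rewrite /= /upd /= s1i s1w sw.
apply: post.
- have := sorted_decr srt lti; rewrite sw /sorted_state /= /upd /=.
  by rewrite s1o s1p s1w s1l; apply.
- by rewrite /= /upd /= s1w.
- move=> b j; rewrite !inE !negb_or => /and5P[b5 b6 b7 b8 /and3P[b17 b18 b19]].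
  rewrite /= /upd (negPf b7) (negPf b8) fr /= /upd ?(negPf b17) //.
  by rewrite !inE !negb_or b5 b6 b18 b19.
- by rewrite rm.
Qed.

Lemma reweight_spec s (K : nat) (bI bJ : bool) i :
  (forall m : nat, (4 <= m%:R * rmem s 0 0) = (K <= m)%N) ->
  (i < n)%N -> nmem s a_i 0 = i -> sorted_state s ->
  nmem s a_I i = bI -> nmem s a_J i = bJ ->
  run_cmd reweight s 27 (fun s' =>
    [/\ sorted_state s',
        nmem s' a_w = update1 (nmem s a_w) i (move_weight K (nmem s a_w i) bI bJ),
        frame [:: a_ord; a_pos; a_w; a_lev; a_p; a_q; a_u] s s'
      & rmem s' = rmem s]).
Proof.
move=> KP lti si srt sI sJ; apply: runs_wp => //.
have same w' : w' = nmem s a_w i -> nmem s a_w = update1 (nmem s a_w) i w'.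
  by move=> ->; apply: boolp.funext => j; rewrite /update1; case: eqP => [->|].
rewrite /move_weight; set post := (fun s' : state R => _).
(* Only the conditionals are unfolded, so that the specifications of the two moves apply to their
   commands. *)
change (wp M1 M2 reweight s post) with
  (if (nmem s a_I (nmem s a_i 0) == 1)%N then
     if (nmem s a_J (nmem s a_i 0) == 1)%N then post s
     else if (0 < nmem s a_w (nmem s a_i 0))%N then wp M1 M2 decrease_weight s post
     else post s
   else if (nmem s a_J (nmem s a_i 0) == 1)%N then
     if 4 <= (nmem s a_w (nmem s a_i 0))%:R * rmem s 0 0 then post s
     else wp M1 M2 increase_weight s post
   else post s).
rewrite KP si sI sJ !eqb1 ltnNge.
case: bI @post {sI} => post; case: bJ @post {sJ} => post; lazy beta iota.
- rewrite /post; by split=> //; exact: same.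
- case: ltnP => w0; last by split=> //; apply: same; lia.
  refine (wp_decrease si erefl w0 lti srt _) => s' srt' w' fr rm; split=> //.
  by rewrite w' subn1.
- case: leqP => wK; lazy beta iota; first by split; [|apply: same; rewrite ltnNge wK| |].
  refine (wp_increase si erefl lti srt _) => s' srt' w' fr rm; split=> //.
  by rewrite w' wK.
- by split; [|exact: same| |].
Qed.

Lemma record_spec s i :
  nmem s a_i 0 = i ->
  run_cmd record_step s 7 (fun s' =>
    [/\ nmem s' a_cI = update1 (nmem s a_cI) i (nmem s a_cI i + nmem s a_I i)%N /\
        nmem s' a_cJ = update1 (nmem s a_cJ) i (nmem s a_cJ i + nmem s a_J i)%N,
        nmem s' a_I = update1 (nmem s a_I) i 0 /\
        nmem s' a_J = update1 (nmem s a_J) i 0,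
        frame [:: a_cI; a_cJ; a_I; a_J] s s'
      & rmem s' = upd (rmem s) 1 i
          ((minn (nmem s a_cI i + nmem s a_I i) (nmem s a_cJ i + nmem s a_J i))%:R
             / (nmem s a_t 0)%:R)]).
Proof.
move=> si; apply: runs_wp => //; rewrite /record_step.
set cI := (nmem s a_cI i + _)%N; set cJ := (nmem s a_cJ i + _)%N.
refine (wp_nset_seq (iv := i) (ev := cI) _ _ _) => [//||].
  by rewrite /= si.
refine (wp_nset_seq (iv := i) (ev := cJ) _ _ _) => [//||].
  by rewrite /= /upd /= si.
refine (wp_nset_seq (iv := i) (ev := 0%N) _ _ _) => [//|//|].
refine (wp_nset_seq (iv := i) (ev := 0%N) _ _ _) => [//|//|].
set m := upd _ a_J _ _; set r := rmem _.
have mi : m a_i 0 = i by [].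
have mcI : m a_cI i = cI by rewrite /m /upd /= eqxx.
have mcJ : m a_cJ i = cJ by rewrite /m /upd /= eqxx.
have frm b j : b \notin [:: a_cI; a_cJ; a_I; a_J] -> m b j = nmem s b j.
  rewrite !inE !negb_or => /and4P[/negPf b1 /negPf b2 /negPf b3 /negPf b4].
  by rewrite /m /upd /= b1 b2 b3 b4.
have final c : c = minn cI cJ ->
    [/\ m a_cI = update1 (nmem s a_cI) i cI /\ m a_cJ = update1 (nmem s a_cJ) i cJ,
        m a_I = update1 (nmem s a_I) i 0 /\ m a_J = update1 (nmem s a_J) i 0,
        frame [:: a_cI; a_cJ; a_I; a_J] s (State m r)
      & upd r 1 i (c%:R / (nmem s a_t 0)%:R) = upd (rmem s) 1 i
          ((minn cI cJ)%:R / (nmem s a_t 0)%:R)].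
  by move=> ->; split.
have mt : m a_t 0 = nmem s a_t 0 by [].
move: m r mi mcI mcJ frm final mt => m r mi mcI mcJ frm final mt.
rewrite /= mi mcI mcJ mt.
by case: ifP => lt; [apply: (final cI)|apply: (final cJ)]; lia.
Qed.

(** The loop visits elements by rank and not by position, so exchanges in [a_ord] do not disturb it:
    ranks below [i] are finished, the others keep their old weights and counts. *)
Lemma update_spec s (I J : {set V}) (K t : nat) (eps : R) :
  nmem s 0 0 = n -> codes (nmem s a_I) I -> codes (nmem s a_J) J ->
  sorted_state s -> nmem s a_t 0 = t -> rmem s 0 0 = eps ->
  (forall m : nat, (4 <= m%:R * eps) = (K <= m)%N) ->
  run_cmd (for_loop (Seq reweight record_step)) s (n * 36 + 2) (fun s' =>
    [/\ sorted_state s',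
        forall x,
          [/\ nmem s' a_w (enum_rank x) =
                move_weight K (nmem s a_w (enum_rank x)) (x \in I) (x \in J),
              nmem s' a_cI (enum_rank x) =
                (nmem s a_cI (enum_rank x) + (x \in I))%N,
              nmem s' a_cJ (enum_rank x) =
                (nmem s a_cJ (enum_rank x) + (x \in J))%N
            & rmem s' 1 (enum_rank x) = (minn (nmem s' a_cI (enum_rank x))
                (nmem s' a_cJ (enum_rank x)))%:R / t%:R],
        codes (nmem s' a_I) (set0 : {set V}) /\
          codes (nmem s' a_J) (set0 : {set V}),
        [/\ nmem s' 0 0 = n, nmem s' a_t 0 = t & nmem s' a_size0 0 = nmem s a_size0 0]
      & rmem s' 0 0 = eps]).
Proof.
move=> sn cI cJ srt st se KP.
pose w x := nmem s a_w (enum_rank x).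
pose cntI x := nmem s a_cI (enum_rank x).
pose cntJ x := nmem s a_cJ (enum_rank x).
pose Inv i s1 :=
  [/\ sorted_state s1,
      forall x, if (enum_rank x < i)%N then
          [/\ nmem s1 a_w (enum_rank x) = move_weight K (w x) (x \in I) (x \in J),
              nmem s1 a_cI (enum_rank x) = (cntI x + (x \in I))%N,
              nmem s1 a_cJ (enum_rank x) = (cntJ x + (x \in J))%N
            & rmem s1 1 (enum_rank x) = (minn (nmem s1 a_cI (enum_rank x))
                (nmem s1 a_cJ (enum_rank x)))%:R / t%:R]
        else [/\ nmem s1 a_w (enum_rank x) = w x,
              nmem s1 a_cI (enum_rank x) = cntI x
            & nmem s1 a_cJ (enum_rank x) = cntJ x],
      forall x,
        nmem s1 a_I (enum_rank x) = (i <= enum_rank x)%N && (x \in I) /\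
        nmem s1 a_J (enum_rank x) = (i <= enum_rank x)%N && (x \in J),
      nmem s1 a_t 0 = t /\ nmem s1 a_size0 0 = nmem s a_size0 0
    & rmem s1 0 0 = eps].
apply: (runs_for (Inv := Inv) (n := n) (b := 34)) => //.
- by split=> // x; split; rewrite /= /upd /= ?cI ?cJ.
- move=> i s1 lti si s1n [srt1 old flags [s1t s10] s1e].
  have [x xi] := rank_of lti.
  have [xI xJ] := flags x; rewrite xi leqnn /= in xI xJ.
  have [xw xcI xcJ] : [/\ nmem s1 a_w i = w x, nmem s1 a_cI i = cntI x
      & nmem s1 a_cJ i = cntJ x] by have := old x; rewrite xi ltnn.
  change 34%N with (27 + 7)%N; apply: runs_seq.
  have KP1 m : (4 <= m%:R * rmem s1 0 0) = (K <= m)%N by rewrite s1e.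
  refine (runs_mono (reweight_spec KP1 lti si srt1 xI xJ) _).
  move=> s2 [srt2 w2 fr2 rm2].
  have s2i : nmem s2 a_i 0 = i by rewrite fr2.
  refine (runs_mono (record_spec s2i) _).
  move=> s3 [[cI3 cJ3] [I3 J3] fr3 rm3].
  have w3 : nmem s3 a_w = nmem s2 a_w by apply: boolp.funext => j; rewrite fr3.
  split; [by rewrite fr3|by rewrite fr3 // fr2|].
  have same y : (enum_rank y == i :> nat) = (y == x).
    by rewrite -xi (inj_eq val_inj) (inj_eq enum_rank_inj).
  split=> /=.
  + have -> : sorted_state (set_i s3 i.+1) = sorted_state s2; last by [].
    have e b : b \in [:: a_ord; a_pos; a_w; a_lev] -> nmem (set_i s3 i.+1) b = nmem s2 b.
      rewrite !inE => bb; apply: boolp.funext => j; rewrite /= /upd.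
      by rewrite -fr3; [case: b bb => [|[]]|case/or4P: bb => /eqP->].
    by rewrite /sorted_state !e.
  + move=> y; rewrite /= /upd /= w3 w2 cI3 cJ3 rm3 rm2 /update1 /upd /= same !fr2 //=.
    rewrite xcI xcJ xI xJ s1t xw.
    case: (eqVneq y x) => [->|nyx]; first by rewrite xi ltnS leqnn.
    have := old y; rewrite ltnS (leq_eqVlt (enum_rank y)) same (negPf nyx) /=.
    by case: ifP.
  + move=> y; rewrite /upd /= I3 J3 /update1 same !fr2 //.
    have [-> ->] := flags y; case: (eqVneq y x) => [->|nyx].
      by rewrite xi ltnn.
    by rewrite (leq_eqVlt i) eq_sym same (negPf nyx).
  + by rewrite /upd /= !fr3 ?fr2.
  + by rewrite rm3 rm2.
- move=> s1 s1n [srt1 new flags [s1t s10] s1e]; split=> //.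
  + by move=> x; have := new x; rewrite ltn_ord.
  + by split=> x; rewrite inE; have [e1 e2] := flags x; rewrite ?e1 ?e2 leqNgt ltn_ord.
Qed.

Lemma sorted_mono ord pos w lev x y : sorted_by n ord pos w lev ->
  (pos (enum_rank y) < pos (enum_rank x))%N -> (w (enum_rank x) <= w (enum_rank y))%N.
Proof.
move=> [_ posP _ levP] lt; have [px ox] := posP _ (ltn_ord (enum_rank x)).
have [py oy] := posP _ (ltn_ord (enum_rank y)).
case: (posnP (w (enum_rank x))) => [->//|w0].
by rewrite -oy -levP // (ltn_trans lt) // levP // ox.
Qed.

(** * The invariant of the main loop *)

Definition at_elt (f : nat -> nat) x : nat := f (enum_rank x).

(** Keeps the independent sets behind a counter, which makes its quotient by [t] an average of
    indicators. *)
Definition history (M : matroid V) (t : nat) f : Prop :=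
  exists Is : seq {set V}, [/\ size Is = t, all (mem (indep M)) Is
    & forall x, at_elt f x = count (fun S : {set V} => x \in S) Is].

Lemma history_cons (M : matroid V) t f f' I : history M t f -> I \in indep M ->
  (forall x, at_elt f' x = at_elt f x + (x \in I))%N -> history M t.+1 f'.
Proof.
move=> [Is [sz iIs cnt]] iI f'E; exists (I :: Is); split=> /=; first by rewrite sz.
  by rewrite iIs andbT.
by move=> x; rewrite f'E cnt addnC.
Qed.

Definition loop_inv (eps : R) (K r0 t : nat) s : Prop :=
  [/\ [/\ nmem s 0 0 = n, nmem s a_size0 0 = r0, nmem s a_t 0 = t & rmem s 0 0 = eps],
      [/\ codes (nmem s a_I) (set0 : {set V}), codes (nmem s a_J) (set0 : {set V}),
          sorted_state s & forall x, (at_elt (nmem s a_w) x <= K)%N],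
      regret_bound M1 M2 K (r0 + r0) t
        (at_elt (nmem s a_w)) (at_elt (nmem s a_cI)) (at_elt (nmem s a_cJ)),
      history M1 t (nmem s a_cI) /\ history M2 t (nmem s a_cJ)
    & forall x, rmem s 1 (enum_rank x) =
        (minn (at_elt (nmem s a_cI) x) (at_elt (nmem s a_cJ) x))%:R / t%:R].

Lemma body_spec (eps : R) (K r0 t : nat) s :
  (max_common M1 M2 <= r0 + r0)%N ->
  (forall m : nat, (4 <= m%:R * eps) = (K <= m)%N) ->
  loop_inv eps K r0 t s ->
  run_cmd (body algorithm) s (2 * (n * (T + 8)) + n * 36 + 9) (loop_inv eps K r0 t.+1).
Proof.
move=> rr0 KP [[sn s0 st se] [cod1 cod2 srt wK] reg [hI hJ] _].
have -> : (2 * (n * (T + 8)) + n * 36 + 9 =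
  1 + (n * (T + 8) + 3 + (n * (T + 8) + 3 + (n * 36 + 2))))%N by lia.
apply: runs_seq; apply: runs_wp => //.
refine (wp_nset (iv := 0%N) (ev := t.+1) _ _ _) => [//||].
  by rewrite /= st addn1.
set s1 := State _ _; apply: runs_seq.
have n1 : nmem s1 0 0 = n by [].
refine (runs_mono (@greedy_spec false s1 _ n1 cod1 srt) _).
move=> s2 [I [cI gI fr2 rm2]]; apply: runs_seq.
have n2 : nmem s2 0 0 = n by rewrite fr2.
have cod2' : codes (nmem s2 a_J) (set0 : {set V}).
  by move=> x; rewrite fr2 //; exact: cod2.
have eq2 b : b \notin [:: a_i; a_ans; a_size; a_v; a_I] -> nmem s2 b = nmem s1 b.
  by move=> bn; apply: boolp.funext => j; exact: fr2.
have srt2 : sorted_by n (nmem s2 a_ord) (nmem s2 a_pos) (nmem s2 a_w) (nmem s2 a_lev).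
  by rewrite !eq2.
refine (runs_mono (@greedy_spec true s2 _ n2 cod2' srt2) _).
move=> s3 [J [cJ gJ fr3 rm3]].
have eq3 b : b \notin [:: a_i; a_ans; a_size; a_v; a_I; a_J] -> nmem s3 b = nmem s1 b.
  rewrite !inE !negb_or => /and5P[b1 b2 b3 b4 /andP[b5 b6]].
  apply: boolp.funext => j; rewrite fr3 ?fr2 // !inE !negb_or ?b1 ?b2 ?b3 ?b4 //.
have cI3 : codes (nmem s3 a_I) I by move=> x; rewrite fr3 // cI.
have n3 : nmem s3 0 0 = n by rewrite eq3.
have srt3 : sorted_state s3 by rewrite /sorted_state !eq3.
have t3 : nmem s3 a_t 0 = t.+1 by rewrite eq3.
have e3 : rmem s3 0 0 = eps by rewrite rm3 rm2.
refine (runs_mono (update_spec n3 cI3 cJ srt3 t3 e3 KP) _).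
move=> s4 [srt4 new [cod1' cod2''] [n4 t4 s40] e4].
have r1 : nmem s1 a_size0 0 = r0 by [].
have r2 : nmem s2 a_size0 0 = r0 by rewrite eq2.
rewrite r1 in gI; rewrite r2 in gJ.
have wE x : at_elt (nmem s4 a_w) x =
    move_weight K (at_elt (nmem s a_w) x) (x \in I) (x \in J).
  by rewrite /at_elt; have [-> _ _ _] := new x; rewrite eq3.
have cIE x : at_elt (nmem s4 a_cI) x = (at_elt (nmem s a_cI) x + (x \in I))%N.
  by rewrite /at_elt; have [_ -> _ _] := new x; rewrite eq3.
have cJE x : at_elt (nmem s4 a_cJ) x = (at_elt (nmem s a_cJ) x + (x \in J))%N.
  by rewrite /at_elt; have [_ _ -> _] := new x; rewrite eq3.
split.
- by split=> //; rewrite s40 eq3.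
- by split=> // x; rewrite wE; exact: move_weight_le.
- rewrite (boolp.funext wE) (boolp.funext cIE) (boolp.funext cJE).
  apply: regret_bound_step reg rr0 wK gI gJ _ _ => x y /=.
    exact: sorted_mono srt.
  rewrite eq2 // => lt; apply: (sorted_mono srt).
  have flip (m a b : nat) : (m - 1 - a < m - 1 - b -> b < a)%N by lia.
  exact: flip lt.
- split; first exact: history_cons hI (truncW gI.1) cIE.
  exact: history_cons hJ (truncW gJ.1) cJE.
- by move=> x; have [_ _ _ ->] := new x.
Qed.

(** Under the invariant the guard depends on the iteration number alone, so the loop runs exactly
    until [g] first fails. *)
Lemma iterate_until (b : bexp) c (g : pred nat) (Inv : nat -> state R -> Prop) B N :
  (forall t s, Inv t s -> beval s b = g t) ->
  (forall t s, Inv t s -> g t -> run_cmd c s B (Inv t.+1)) ->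
  (forall t, (t < N)%N -> g t) -> ~~ g N ->
  forall s, Inv 0%N s -> exists s' ks,
    [/\ iterate M1 M2 t1 t2 b c s s' ks, Inv N s', size ks = N
      & forall k, k \in ks -> (k <= B.+1)%N].
Proof.
move=> guardE step before stop.
suff main : forall m t s, (m + t = N)%N -> Inv t s -> exists s' ks,
    [/\ iterate M1 M2 t1 t2 b c s s' ks, Inv N s', size ks = m
      & forall k, k \in ks -> (k <= B.+1)%N].
  by move=> s; apply: main; rewrite addn0.
elim=> [|m IH] t s mt inv.
  exists s, [::]; split=> //; last by rewrite -mt.
  by apply: iterate_stop; rewrite (guardE t) // -[t]add0n mt.
have gt : g t by apply: before; lia.
have [s1 [k [ek bk inv1]]] := step t s inv gt.
have mt1 : (m + t.+1 = N)%N by lia.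
have [s2 [ks [it inv2 sz bks]]] := IH t.+1 s1 mt1 inv1.
exists s2, (k.+1 :: ks); split=> //=; last 2 first.
- by rewrite sz.
- by move=> k'; rewrite inE => /predU1P[->|/bks].
by apply: iterate_step ek it; rewrite (guardE t).
Qed.

End Correctness.

(** * Accuracy, number of iterations and time *)

(** [K] is the ceiling of [4 / eps], described by the comparison that the program performs. *)
Lemma least_multiple (R : realType) (eps : R) : 0 < eps ->
  exists K : nat, forall m : nat, (4 <= m%:R * eps) = (K <= m)%N.
Proof.
move=> eps0; have ex : exists m : nat, 4 <= m%:R * eps.
  exists (Num.bound (4 / eps)); rewrite -ler_pdivrMr // ltW // archi_boundP //.
  by rewrite divr_ge0 // ltW.
case: (ex_minnP ex) => K K4 minK; exists K => m; apply/idP/idP; first exact: minK.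
by move=> Km; apply: le_trans K4 _; rewrite ler_wpM2r ?ler_nat // ltW.
Qed.

Theorem theorem7p2 (R : realType) :
  exists (A : iterative_algorithm) (C : nat),
  forall (V : finType) (M1 M2 : matroid V) (t1 t2 : {set V} -> nat) (eps : R),
    (forall S, (0 < t1 S)%N) -> (forall S, (0 < t2 S)%N) -> 0 < eps ->
    let n := #|V| in
    let r := max_common M1 M2 in
    exists (z : {ffun V -> R}) (k0 : nat) (ks : seq nat),
      [/\ run M1 M2 t1 t2 A eps z k0 ks,
          in_matroid_polytope M1 z /\ in_matroid_polytope M2 z,
          (1 - eps) * r%:R <= \sum_(v : V) z v,
          (0 < r)%N ->
            (size ks)%:R <= C%:R * (n%:R / (r%:R * eps ^+ 2))
        & (k0 <= C * (n * Tind t1 t2).+1)%N /\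
          (forall k, k \in ks -> (k <= C * (n * Tind t1 t2))%N)].
Proof.
(* 64 = 2 + 52 + 10: with its guard test an iteration costs at most [2 * n * T + 52 * n + 10], where
   [T] is the maximum query time, and [n] and 1 are at most [n * T] once [n > 0]. The other bounds
   fit as well. *)
exists algorithm, 64%N => V M1 M2 t1 t2 eps t1pos t2pos eps0 n r.
have [K KP] := least_multiple eps0.
have T0 : (0 < Tind t1 t2)%N.
  exact: leq_trans (t1pos set0) (query_time_le t1 t2 false set0).
have nT : (n <= n * Tind t1 t2)%N by rewrite leq_pmulr.
have [s0 [k [ek bk [S [[i1 i2 s0r maxS] ord0 zero s0n rm0]]]]] :=
  init_spec M1 M2 t1 t2 eps.
set r0 := #|S| in s0r.
have rr0 : (r <= r0 + r0)%N by rewrite addnn -mul2n; exact: maximal_common_half.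
have r0r : (r0 <= r)%N by exact: max_common_ge.
have rn : (r <= n)%N.
  by rewrite /r; have [O [_ _ <-]] := max_common_witness M1 M2; exact: max_card.
have inv0 : loop_inv M1 M2 eps K r0 0 s0.
  have z0 b : (a_w <= b)%N -> b != a_ans' -> at_elt (nmem s0 b) = fun _ : V => 0%N.
    by move=> b1 b2; apply: boolp.funext => x; rewrite /at_elt zero.
  split.
  - by split; [exact: s0n|exact: s0r|exact: zero|rewrite rm0].
  - split.
    + by move=> x; rewrite zero // inE.
    + by move=> x; rewrite zero // inE.
    + split=> [i lti|v ltv|k' _|k' i k0 lti]; last by rewrite !zero //; case: k' k0.
      * by have [-> e] := ord0 i lti; split.
      * by have [e ->] := ord0 v ltv; split=> //; rewrite e.
      * by rewrite zero.
    + by move=> x; rewrite z0.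
  - by rewrite !z0 //; exact: regret_bound0.
  - by split; exists [::]; split=> // x; rewrite z0.
  - by move=> x; rewrite !z0 // rm0 mul0r.
pose g t := [&& (0 < r0)%N, ~~ (1 <= eps) &
  ~~ (5 * n%:R <= t%:R * r0%:R * (eps * eps))].
have guardE t s : loop_inv M1 M2 eps K r0 t s -> beval s (guard algorithm) = g t.
  by move=> [[e1 e2 e3 e4] _ _ _ _]; rewrite /= e1 e2 e3 e4.
have exN : exists N, ~~ g N.
  case: (posnP r0) => [r00|r0pos]; first by exists 0%N; rewrite /g r00.
  have den : 0 < r0%:R * (eps * eps) by rewrite !mulr_gt0 // ltr0n.
  exists (Num.bound (5 * n%:R / (r0%:R * (eps * eps)))).
  rewrite /g r0pos /= negb_and !negbK; apply/orP; right.
  rewrite -mulrA -ler_pdivrMr // ltW // archi_boundP //.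
  by rewrite divr_ge0 ?(ltW den) // mulr_ge0.
case: (ex_minnP exN) => N stop minN.
have before t : (t < N)%N -> g t.
  by move=> lt; apply: contraTT lt => /minN; rewrite -leqNgt.
have step t s : loop_inv M1 M2 eps K r0 t s -> g t ->
    runs M1 M2 t1 t2 (body algorithm) s
      (2 * (n * (Tind t1 t2 + 8)) + n * 36 + 9) (loop_inv M1 M2 eps K r0 t.+1).
  by move=> inv _; exact: body_spec.
have [s1 [ks [it inv sz bks]]] := iterate_until guardE step before stop inv0.
have [_ [_ _ _ _] reg [[Is [szI iIs cntI]] [Js [szJ iJs cntJ]]] outE] := inv.
pose m (x : V) := minn (at_elt (nmem s1 a_cI) x) (at_elt (nmem s1 a_cJ) x).
have zE x : output V s1 x = (m x)%:R / N%:R by rewrite ffunE outE.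
have sumE : \sum_v output V s1 v = (\sum_v m v)%N%:R / N%:R.
  by rewrite natr_sum mulr_suml; apply: eq_bigr => x _.
exists (output V s1), k.+1, ks; split.
- by exists s0, s1, k; split.
- split.
  + apply: (below_average_in_polytope iIs (m := m)) => x; rewrite ?szI ?zE //.
    by rewrite -cntI geq_minl.
  + apply: (below_average_in_polytope iJs (m := m)) => x; rewrite ?szJ ?zE //.
    by rewrite -cntJ geq_minr.
- have sum0 : 0 <= \sum_v output V s1 v by rewrite sumE divr_ge0.
  (* If the loop stops because [r0 = 0] or [eps >= 1], the required lower bound is at most 0. *)
  move: stop; rewrite /g !negb_and !negbK -leqNgt => /or3P[r00|eps1|big].
  + by have -> : r = 0%N by [lia]; rewrite mulr0.
  + by apply: le_trans sum0; rewrite mulr_le0_ge0 // subr_le0.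
  case: (posnP r0) => [r00|r0pos]; first by have -> : r = 0%N by [lia]; rewrite mulr0.
  case: (leP 1 eps) => [eps1|eps1].
    by apply: le_trans sum0; rewrite mulr_le0_ge0 // subr_le0.
  have n0 : (0 < n)%N by lia.
  have N0 : (0 < N)%N.
    rewrite lt0n; apply: contraTneq big => ->.
    by rewrite !mul0r -ltNge mulr_gt0 // ltr0n.
  have K4 : 4 <= K%:R * eps by rewrite KP.
  (* By minimality of [K], [(K - 1) * eps < 4]; moreover [eps < 1]. *)
  have K5 : K%:R * eps <= 5.
    have := KP K.-1; case: (K) K4 => [|K'] K4; first by move: K4; rewrite mul0r; lra.
    by rewrite ltnn => /negbT; rewrite -ltNge /= -natr1; lra.
  rewrite sumE; apply: (@regret_value R n r r0 K N _ eps) => //.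
  (* This competitor selects the smaller count at each element, turning the mixed sum into the sum
     of the minima. *)
  pose U := [set x : V | (at_elt (nmem s1 a_cI) x < at_elt (nmem s1 a_cJ) x)%N].
  have <- : (\sum_x (if x \in U then at_elt (nmem s1 a_cI) x
      else at_elt (nmem s1 a_cJ) x) = \sum_x m x)%N.
    by apply: eq_bigr => x _; rewrite inE /m; case: ltnP.
  by apply: leq_trans (reg U); exact: leq_addr.
- move=> rpos; rewrite sz; case: (posnP N) => [->|N0].
    by rewrite mulr_ge0 // divr_ge0 // mulr_ge0 // exprn_ge0 // ltW.
  (* The guard held at [N - 1], so [(N - 1) * r0 * eps ^ 2 < 5 * n]. With [r <= 2 * r0] this bounds
     [(N - 1) * r * eps ^ 2] by [10 * n], and the last iteration adds [r * eps ^ 2 <= n]. *)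
  have /and3P[r0pos] : g N.-1 by apply: before; lia.
  rewrite -!ltNge => eps1 small.
  have den : 0 < r%:R * eps ^+ 2 by rewrite mulr_gt0 ?exprn_gt0 // ltr0n.
  rewrite mulrA ler_pdivlMr // expr2.
  have NE : N%:R = N.-1%:R + 1 :> R by rewrite natr1 prednK.
  have ee0 : 0 <= eps * eps by rewrite mulr_ge0 // ltW.
  have ee1 : eps * eps <= 1 by rewrite mulr_ile1 // ltW.
  have rr0' : r%:R <= r0%:R + r0%:R :> R by rewrite -natrD ler_nat.
  have rn' : r%:R <= n%:R :> R by rewrite ler_nat.
  have h1 : r%:R * (eps * eps) <= n%:R by rewrite -[n%:R]mulr1 ler_pM.
  have h2 : N.-1%:R * (r%:R * (eps * eps)) <= N.-1%:R * ((r0%:R + r0%:R) * (eps * eps)).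
    by rewrite ler_wpM2l // ler_wpM2r.
  rewrite NE; lra.
- split; first by move: bk; rewrite -/n; nia.
  move=> k' k'ks; have := bks k' k'ks; rewrite -/n => le.
  (* An iteration took place, so the guard held at 0 and the ground set is nonempty; hence [n * T]
     absorbs the additive constants. *)
  have /and3P[r0pos _ _] : g 0%N.
    by apply: before; rewrite -sz; case: (ks) k'ks.
  have n0 : (0 < n)%N by lia.
  nia.
Qed.
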